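(* Define integers $N_r$ for $r=0,1,\ldots,13$ by $N_0=294$, $N_1=589$, $N_2=394$, $N_3=367$, $N_4=396$, $N_5=439$, $N_6=510$, $N_7=329$, $N_8=540$, $N_9=457$, $N_{10}=430$, $N_{11}=459$, $N_{12}=432$, $N_{13}=447$. For each $r\in\{0,1,\ldots,13\}$, if $n\equiv r \pmod{14}$ and $n\ge N_r+112$, then the double cover $\tilde A_n$ of the alternating group $A_n$ is a doubly Hurwitz Beauville group. In particular, this applies for all $n\ge 701$.
   Context: For $n\ge 4$, the double cover $\tilde A_n=2.A_n$ is the unique (up to isomorphism) group $G$ with a central involution $\iota$ contained in the commutator subgroup $G'$ such that $G/\langle\iota\rangle\cong A_n$. A generating triple of type $(2,3,7)$ (a Hurwitz triple) for a finite group $G$ is a triple $(x,y,z)$ of elements of $G$ of orders $2,3,7$ respectively, with $xyz=1$ and $G=\langle x,y,z\rangle$. A finite group $G$ is a doubly Hurwitz Beauville group (dHB group) if it has two generating triples $(x_1,y_1,z_1)$ and $(x_2,y_2,z_2)$ of type $(2,3,7)$ such that no non-identity power of $x_1$, $y_1$ or $z_1$ is conjugate in $G$ to a power of $x_2$, $y_2$ or $z_2$. *)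

(* Defs.v *)
From mathcomp Require Import all_boot all_fingroup all_solvable.
Set Implicit Arguments.
Unset Strict Implicit.
Unset Printing Implicit Defensive.

Local Open Scope group_scope.

(* The double cover of 'Alt_'I_n is characterized up to isomorphism (n >= 4). *)
Definition is_double_cover_Alt (n : nat) (gT : finGroupType) (G : {group gT}) :=
  exists iota : gT,
    [/\ iota \in 'Z(G), #[iota] = 2, iota \in G^`(1)
      & G / <[iota]> \isog 'Alt_'I_n].

Definition hurwitz_triple (gT : finGroupType) (G : {group gT}) (x y z : gT) :=
  [/\ [/\ x \in G, y \in G & z \in G],
      [/\ #[x] = 2, #[y] = 3 & #[z] = 7],
      x * y * z = 1
    & <<[set x; y; z]>> = G].

Definition doubly_hurwitz_beauville (gT : finGroupType) (G : {group gT}) :=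
  exists x1 y1 z1 x2 y2 z2 : gT,
    [/\ hurwitz_triple G x1 y1 z1,
        hurwitz_triple G x2 y2 z2
      & forall (u v : gT) (i j : nat),
          u \in [set x1; y1; z1] -> v \in [set x2; y2; z2] ->
          u ^+ i != 1 -> v ^+ j \notin (u ^+ i) ^: G].

Definition hurwitz_bound (r : nat) : nat :=
  nth 0 [:: 294; 589; 394; 367; 396; 439; 510;
            329; 540; 457; 430; 459; 432; 447] r.

(* Main.v *)
Require Import Defs.
From mathcomp Require Import all_boot all_fingroup all_solvable.
From mathcomp Require Import zify.
Set Implicit Arguments.
Unset Strict Implicit.
Unset Printing Implicit Defensive.

(** In the double cover of the alternating group, lifts of disjoint double
    transpositions commute (each is a product of two lifts of 3-cycles) and
    have the same square, so an involution moving 8k points lifts to an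
    involution.  A (2,3,7)-pair (x, y) generating the alternating group, with
    such an x, therefore lifts to a Hurwitz triple; and two pairs for which x,
    y and xy have different numbers of fixed points lift to triples without
    conjugate nontrivial powers.

    The pairs come from Higman's and Conder's method of coset diagrams.  Two
    diagrams are joined through handles: if x fixes a, b = y(a), a' and
    b' = y(a'), adding the transpositions (a a')(b b') to x preserves the
    relations.  Every degree is reached by a chain head-middle-...-middle-cap
    of twelve fixed diagrams.  In every such chain all cycles of
    w = x y x y^-1 stay within two consecutive diagrams and have length prime
    to 17, except for one 17-cycle inside the head, so some power of w is a
    17-cycle.  It has a conjugate whose support meets its own in a single
    point; their commutator is a 3-cycle.  "Equal or exchanged by a
    3-cycle of the group" is an invariant equivalence relation, and the class
    of the 17-cycle is stable under x and y, hence everything. *)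

Local Open Scope group_scope.

Local Ltac neq := try by [|rewrite eq_sym].

(** * Three-cycles *)

Section ThreeCycles.

Variable T : finType.
Implicit Types (a b c d p s : T) (g h : {perm T}) (G : {group {perm T}}).

Definition cyc3 a b c : {perm T} := tperm a b * tperm a c.

Lemma cyc3J a b c g : cyc3 a b c ^ g = cyc3 (g a) (g b) (g c).
Proof. by rewrite /cyc3 conjMg !tpermJ. Qed.

Lemma cyc3V a b c : (cyc3 a b c)^-1 = cyc3 a c b.
Proof. by rewrite /cyc3 invMg !tpermV. Qed.

Lemma cyc3_spec a b c g : a != b -> b != c -> a != c ->
  g a = b -> g b = c -> g c = a ->
  (forall p, p != a -> p != b -> p != c -> g p = p) -> g = cyc3 a b c.
Proof.
move=> ab bc ac ga gb gc gp; apply/permP=> p; rewrite permM.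
have [->|pa] := eqVneq p a; first by rewrite tpermL ga tpermD // eq_sym.
have [->|pb] := eqVneq p b; first by rewrite tpermR gb tpermL.
rewrite (tpermD (z := p)) 1?eq_sym //.
have [->|pc] := eqVneq p c; first by rewrite tpermR gc.
by rewrite tpermD 1?eq_sym // gp.
Qed.

Lemma cyc3_rot a b c : a != b -> b != c -> a != c -> cyc3 a b c = cyc3 b c a.
Proof.
move=> ab bc ac; apply: cyc3_spec; neq.
- by rewrite permM tpermR tpermL.
- by rewrite permM (tpermD (z := c)) ?tpermR.
- by rewrite permM tpermL tpermD // eq_sym.
by move=> p pb pc pa; rewrite /cyc3 permM !tpermD // eq_sym.
Qed.

Lemma cyc3_neq1 a b c : a != b -> b != c -> cyc3 a b c != 1.
Proof.
move=> ab bc; apply/eqP=> /permP/(_ a).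
by rewrite permM perm1 tpermL; case: tpermP => // [ba|cb _]; 
  [rewrite ba eqxx in ab|rewrite cb eqxx in bc].
Qed.

Lemma cyc3_Alt a b c : a != b -> a != c -> cyc3 a b c \in 'Alt_T.
Proof. by move=> ab ac; rewrite Alt_even odd_permM !odd_tperm ab ac. Qed.

Definition linked G a b :=
  a = b \/ exists c, [/\ a != b, b != c, a != c & cyc3 a b c \in G].

Lemma linkedJ G g a b : g \in G -> linked G a b -> linked G (g a) (g b).
Proof.
move=> Gg [->|[c [ab bc ac Gt]]]; first by left.
by right; exists (g c); rewrite !(inj_eq perm_inj) -cyc3J groupJ.
Qed.

Lemma linked_sym G a b : linked G a b -> linked G b a.
Proof.
case=> [->|[c [ab bc ac Gt]]]; first by left.
right; exists c; split; neq.
by rewrite cyc3_rot; neq; rewrite -groupV cyc3V.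
Qed.

(** If $e\ne a$, the 3-cycle $(b\,d\,e)$ fixes $a$ and conjugates $(a\,b\,c)$ to a 3-cycle taking
    $a$ to $d$, wherever it sends $c$. If $e=a$, its inverse already takes $a$ to $d$. *)
Lemma linked_trans G b a d : linked G a b -> linked G b d -> linked G a d.
Proof.
move=> Lab [<- //|[e [bd de be Gg]]]; case: Lab => [->|[c [ab bc ac Gt]]].
  by right; exists e.
have [->|ad] := eqVneq a d; first by left.
right; have [ea|ea] := eqVneq e a.
  exists b; split; neq.
  by rewrite -groupV cyc3V cyc3_rot -?ea; neq.
exists (cyc3 b d e c).
have ga : cyc3 b d e a = a by rewrite permM !tpermD // eq_sym.
have gb : cyc3 b d e b = d by rewrite permM tpermL tpermD // eq_sym.
split=> //; first by rewrite -{1}gb (inj_eq perm_inj).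
  by rewrite -{1}ga (inj_eq perm_inj).
by have := groupJ Gt Gg; rewrite cyc3J ga gb.
Qed.

(** From $(a\,b\,d)$ and $(d\,c\,e)$ in [G]: if $e$ is neither $a$ nor $b$, conjugating the first by
    the second replaces $d$ by $c$. If $e$ is $a$ or $b$, conjugating twice yields the inverse of
    $(a\,b\,c)$. *)
Lemma cyc3_mem_linked G : (forall a b, linked G a b) ->
  forall a b c, a != b -> b != c -> a != c -> cyc3 a b c \in G.
Proof.
move=> lk a b c ab bc ac.
case: (lk a b) => [/eqP|[d [_ bd ad Gg]]]; first by rewrite (negPf ab).
case: (lk d c) => [<- //|[e [dc ce de Gh]]].
have hd : cyc3 d c e d = c by rewrite permM tpermL tpermD // eq_sym.
have hc : cyc3 d c e c = e by rewrite permM tpermR tpermL.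
have hp p : p != d -> p != c -> p != e -> cyc3 d c e p = p.
  by move=> *; rewrite permM !tpermD // eq_sym.
have he : cyc3 d c e e = d by rewrite permM (tpermD (z := e)) ?tpermR.
have [ea|ea] := eqVneq e a.
  subst e; have hb : cyc3 d c a b = b by apply: hp; neq.
  have := groupJ (groupJ Gg Gh) Gh; rewrite !cyc3J hb he hd hc hb => Gk.
  by rewrite -groupV cyc3V cyc3_rot; neq.
have [eb|eb] := eqVneq e b.
  subst e; have ha : cyc3 d c b a = a by apply: hp; neq.
  have := groupJ (groupJ Gg Gh) Gh; rewrite !cyc3J !ha he hd hc => Gk.
  by rewrite -groupV cyc3V.
have ha : cyc3 d c e a = a by apply: hp; neq.
have hb : cyc3 d c e b = b by apply: hp; neq.
by have := groupJ Gg Gh; rewrite cyc3J hd ha hb.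
Qed.

(** The 3-cycles generate a nontrivial normal subgroup of the alternating group, which is simple in
    degree at least 5. *)
Lemma Alt_sub_linked G : 4 < #|T| -> (forall a b, linked G a b) ->
  'Alt_T \subset G.
Proof.
move=> T5 lk; pose S := [set g | [exists a, exists b, exists c,
  [&& a != b, b != c, a != c & g == cyc3 a b c]]].
have memS a b c : a != b -> b != c -> a != c -> cyc3 a b c \in S.
  move=> ab bc ac; rewrite inE; apply/existsP; exists a; apply/existsP; exists b.
  by apply/existsP; exists c; rewrite ab bc ac eqxx.
have SP g : g \in S -> exists a b c, [/\ a != b, b != c, a != c & g = cyc3 a b c].
  rewrite inE => /existsP[a /existsP[b /existsP[c /and4P[ab bc ac /eqP->]]]].
  by exists a, b, c.
have sSG : <<S>> \subset G.
  rewrite gen_subG; apply/subsetP=> g /SP[a [b [c [ab bc ac ->]]]].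
  exact: cyc3_mem_linked.
have nS : <<S>> <| 'Alt_T.
  apply/andP; split.
    rewrite gen_subG; apply/subsetP=> g /SP[a [b [c [ab bc ac ->]]]].
    exact: cyc3_Alt.
  apply: norms_gen; apply/subsetP=> h _; rewrite inE; apply/subsetP=> g.
  case/imsetP=> k /SP[a [b [c [ab bc ac ->]]]] ->.
  by rewrite cyc3J memS // (inj_eq perm_inj).
have [_ /(_ _ nS)[S1|<- //]] := simpleP _ (simple_Alt5 T5).
have /card_gt2P[a [b [c [_ [ab bc ca]]]]] : 2 < #|T| by apply: leq_trans T5.
have := mem_gen (memS a b c ab bc _); rewrite eq_sym S1 => /(_ ca)/set1P/eqP.
by rewrite (negPf (cyc3_neq1 _ _)).
Qed.

(* The commutator of [g] and [h] is a 3-cycle. *)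
Lemma linked_commutator G g h s : g \in G -> h \in G ->
  g s != s -> h s != s ->
  (forall p, g p != p -> h p != p -> p = s) -> linked G s (g s).
Proof.
move=> Gg Gh gs hs gh1; right; exists (h s).
have fh p : g p != p -> p != s -> h p = p.
  by move=> gp ps; apply/eqP/(contraNT _ ps) => hp; rewrite (gh1 p).
have fg p : h p != p -> p != s -> g p = p.
  by move=> hp ps; apply/eqP/(contraNT _ ps) => gp; rewrite (gh1 p).
have hb : h (g s) = g s by apply: fh; rewrite ?(inj_eq perm_inj).
have gc : g (h s) = h s by apply: fg; rewrite ?(inj_eq perm_inj).
have bc : g s != h s.
  by apply/eqP=> e; move: gs; rewrite -(inj_eq (@perm_inj _ g)) {1}e gc -e eqxx.
have invE (k : {perm T}) p q : k q = p -> k^-1 p = q by move<-; rewrite permK.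
have fp (k : {perm T}) p : k p = p -> k^-1 p = p by exact: invE.
have vN (k : {perm T}) p : k p != p -> k (k^-1 p) != k^-1 p.
  by rewrite permKV eq_sym; apply: contraNneq => e; rewrite [in k p]e permKV.
split; neq.
suff <- : [~ g, h]^-1 = cyc3 s (g s) (h s) by rewrite groupV groupR.
rewrite -[RHS]invgK cyc3V; congr (_^-1).
apply: cyc3_spec; neq; rewrite /commg /conjg ?mulgA.
- rewrite !permM; have gq := vN _ _ gs.
  have qs : g^-1 s != s by apply: contraNneq gs => e; rewrite -{1}e permKV.
  by rewrite (fp h _ (fh _ gq qs)) permKV.
- by rewrite !permM (fp g) // (invE h _ s).
- rewrite !permM (invE g _ s) //; have hq := vN _ _ hs.
  have qs : h^-1 s != s by apply: contraNneq hs => e; rewrite -{1}e permKV.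
  by rewrite (fg _ hq qs) permKV.
move=> p ps pc pb; rewrite !permM.
have [gp|gp] := eqVneq (g p) p.
  rewrite (fp g) //; have [hp|hp] := eqVneq (h p) p.
    by rewrite (fp h) // gp.
  have rs : h^-1 p != s by apply: contraNneq pc => <-; rewrite permKV.
  by rewrite (fg _ (vN _ _ hp) rs) permKV.
have gq := vN _ _ gp.
have qs : g^-1 p != s by apply: contraNneq pb => <-; rewrite permKV.
by rewrite (fp h _ (fh _ gq qs)) permKV fh.
Qed.

End ThreeCycles.

(** * Lifting to the double cover *)

Section Permutations.
Variable T : finType.
Implicit Types (a b c d q : T) (p : {perm T}).

Definition moved p := [set q | p q != q].

(** The transposition split off is $(a\;p(a))$. The last clause lets transpositions be peeled
    repeatedly: points already peeled are fixed by the remaining factor, hence differ from the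
    points peeled later. *)
Lemma peel_transposition p : involutive p -> 1 < #|moved p| ->
  exists a b p', [/\ a != b, p = tperm a b * p', involutive p',
    p' a = a /\ p' b = b &
    #|moved p| = #|moved p'|.+2 /\
    forall q, p q = q -> [/\ a != q, b != q & p' q = q]].
Proof.
move=> pK /ltnW/card_gt0P[a]; rewrite inE => pa.
pose p' := tperm a (p a) * p.
have p'a : p' a = a by rewrite permM tpermL.
have p'b : p' (p a) = p a by rewrite permM tpermR.
have p'q q : a != q -> p a != q -> p' q = p q by move=> ? ?; rewrite permM tpermD.
exists a, (p a), p'; split=> //; first by rewrite eq_sym.
- by rewrite /p' mulgA tperm2 mul1g.
- move=> q; have [<-|aq] := eqVneq a q; first by rewrite !p'a.
  have [<-|bq] := eqVneq (p a) q; first by rewrite !p'b.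
  rewrite (p'q q) // p'q ?pK //; last by rewrite (inj_eq perm_inj).
  by rewrite -{1}(pK a) (inj_eq perm_inj).
split.
  have -> : moved p = a |: (p a |: moved p').
    apply/setP=> q; rewrite !inE.
    have [->|aq] := eqVneq q a; first by rewrite pa.
    have [->|bq] := eqVneq q (p a); first by rewrite /= pK eq_sym pa.
    by rewrite /= p'q // eq_sym.
  by rewrite !cardsU1 !inE p'a p'b !eqxx !orbF (eq_sym a) pa.
move=> q pq; have aq : a != q by apply: contraNneq pa => ->; rewrite pq.
have bq : p a != q by rewrite -pq (inj_eq perm_inj).
by rewrite p'q.
Qed.

Lemma tperm2_cyc3 a b c d :
  tperm a b * tperm c d = cyc3 a b c * cyc3 c a d.
Proof. by rewrite /cyc3 (tpermC c a) mulgA -(mulgA (tperm a b)) tperm2 mulg1. Qed.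

Lemma cyc3_cube a b c : a != b -> b != c -> a != c -> cyc3 a b c ^+ 3 = 1.
Proof.
move=> ab bc ac; have E q : (cyc3 a b c ^+ 3) q = cyc3 a b c (cyc3 a b c (cyc3 a b c q)).
  by rewrite 2!expgS expg1 !permM.
have ha : cyc3 a b c a = b by rewrite permM tpermL tpermD // eq_sym.
have hb : cyc3 a b c b = c by rewrite permM tpermR tpermL.
have hc : cyc3 a b c c = a by rewrite permM (tpermD (z := c)) ?tpermR.
apply/permP=> q; rewrite E perm1.
have [->|qa] := eqVneq q a; first by rewrite ha hb hc.
have [->|qb] := eqVneq q b; first by rewrite hb hc ha.
have [->|qc] := eqVneq q c; first by rewrite hc ha hb.
by rewrite !permM !tpermD // eq_sym.
Qed.

Lemma commute_cyc3 a b c p : p a = a -> p b = b -> p c = c ->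
  commute (cyc3 a b c) p.
Proof.
by move=> pa pb pc; rewrite /commute conjgC cyc3J pa pb pc.
Qed.

Definition nfix p := #|[set q | p q == q]|.

(** Each of [p] and [p ^+ i] is a power of the other, so they fix the same points. *)
Lemma nfix_expg p i j : p ^+ i ^+ j = p -> nfix (p ^+ i) = nfix p.
Proof.
have sub (r : {perm T}) k : [set q | r q == q] \subset [set q | (r ^+ k) q == q].
  apply/subsetP=> q; rewrite !inE => /eqP rq; apply/eqP.
  by rewrite permX; elim: k => //= k ->.
move=> e; apply/eqP; rewrite eqn_leq !subset_leq_card ?sub //.
by rewrite -{2}e sub.
Qed.

Lemma nfixJ p (r : {perm T}) : nfix (p ^ r) = nfix p.
Proof.
rewrite /nfix -[RHS](card_imset _ (@perm_inj _ r)); apply: eq_card => z.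
rewrite inE; apply/eqP/imsetP=> [e|[t]].
  exists (r^-1 z); last by rewrite permKV.
  by rewrite inE; apply/eqP/(@perm_inj _ r); rewrite permKV -{2}e !permM.
by rewrite inE => /eqP pt ->; rewrite permJ pt.
Qed.

End Permutations.

(** * Lifts through a central extension by an involution *)

Section Lifting.

Variables (gT : finGroupType) (G : {group gT}) (iota : gT) (T : finType).
Variable f : {morphism G >-> {perm T}}.
Hypotheses (Ziota : iota \in 'Z(G)) (iota2 : #[iota] = 2).
Hypotheses (kerf : 'ker f = <[iota]>) (imf : f @* G = 'Alt_T).

Let iiota : iota * iota = 1.
Proof. by rewrite -expg2 -iota2 expg_order. Qed.

Let kerP u : u \in G -> f u = 1 -> u = 1 \/ u = iota.
Proof.
move=> Gu fu; have : u \in 'ker f by apply/kerP.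
rewrite kerf => /cycleP[i ->]; rewrite -(odd_double_half i) expgD -mul2n expgM.
rewrite expg2 iiota expg1n mulg1; case: (odd i); [by right|by left].
Qed.

Let ker_central u v : u \in G -> v \in G -> f u = 1 -> commute u v.
Proof.
move=> Gu Gv /(kerP Gu)[->|->]; first exact/commute_sym/commute1.
by case/setIP: Ziota => _ /centP; apply.
Qed.

Let ker_sqr u : u \in G -> f u = 1 -> u ^+ 2 = 1.
Proof. by move=> Gu /(kerP Gu)[->|->]; rewrite ?expg1n // expg2. Qed.

Let lift p : p \in 'Alt_T -> exists2 u, u \in G & f u = p.
Proof. by rewrite -imf => /morphimP[u _ Gu ->]; exists u. Qed.

Let same_lift u v : u \in G -> v \in G -> f u = f v ->
  exists z, [/\ z \in G, f z = 1 & u = v * z].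
Proof.
move=> Gu Gv e; exists (v^-1 * u); rewrite mulKVg groupM ?groupV //.
by rewrite morphM ?groupV // morphV // e mulVg.
Qed.

(** The commutator $c=[u,v]$ lies in the kernel, so $c$ is central and $c^2=1$. Also $u^3$ lies in
    the kernel, hence $u^3=(u^3)^v=(uc)^3=u^3c^3$ and $c^3=1$. Thus $c=1$. *)
Lemma commute_lift_cyc3 a b c u v : u \in G -> v \in G ->
  a != b -> b != c -> a != c -> f u = cyc3 a b c ->
  f v a = a -> f v b = b -> f v c = c -> commute u v.
Proof.
move=> Gu Gv ab bc ac fu va vb vc.
have fc : f [~ u, v] = 1.
  rewrite morphR // fu; apply/eqP/commgP; exact: commute_cyc3.
have Gc : [~ u, v] \in G by rewrite groupR.
have Eu : u ^ v = u * [~ u, v] by rewrite -conjg_mulR.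
have f3 : f (u ^+ 3) = 1 by rewrite morphX // fu cyc3_cube.
have c3 : [~ u, v] ^+ 3 = 1.
  apply/(mulgI (u ^+ 3)); rewrite mulg1 -expgMn; last first.
    by apply/commute_sym/ker_central.
  by rewrite -Eu -conjXg conjgE (ker_central (groupX 3 Gu) Gv f3) mulKg.
apply/commgP/eqP; rewrite -c3 expgS.
by rewrite ker_sqr ?mulg1.
Qed.


Lemma commute_lift_tperm2 a b c d u v : u \in G -> v \in G ->
  uniq [:: a; b; c; d] -> f u = tperm a b * tperm c d ->
  f v a = a -> f v b = b -> f v c = c -> f v d = d -> commute u v.
Proof.
move=> Gu Gv; rewrite /= !inE !negb_or => /and4P[/and3P[ab ac ad] /andP[bc bd] cd _].
rewrite tperm2_cyc3 => fu va vb vc vd.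
have [r Gr fr] := lift (cyc3_Alt ab ac).
have [|r' Gr' fr'] := @lift (cyc3 c a d); first by rewrite cyc3_Alt // eq_sym.
have [|z [Gz fz ->]] := same_lift Gu (groupM Gr Gr'); first by rewrite morphM // fr fr'.
apply/commute_sym/commuteM; last by apply/commute_sym/ker_central.
apply: commuteM; apply: commute_sym.
  exact: (commute_lift_cyc3 Gr Gv ab bc ac).
by apply: (commute_lift_cyc3 Gr' Gv _ ad cd); rewrite // eq_sym.
Qed.

Lemma tperm2_Alt a b c d : a != b -> c != d -> tperm a b * tperm c d \in 'Alt_T.
Proof. by move=> ab cd; rewrite Alt_even odd_permM !odd_tperm ab cd. Qed.

(** The two lifts commute, so $(u_1u_2)^2=u_1^2u_2^2$. A lift of an even permutation exchanging the
    two supports conjugates $u_1$ to $u_2$ up to a central factor of square 1. As $u_1^2$ is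
    central, the two squares agree, and their product is 1. *)
Lemma lift_tperm4 a1 b1 c1 d1 a2 b2 c2 d2 u1 u2 :
    uniq [:: a1; b1; c1; d1; a2; b2; c2; d2] -> u1 \in G -> u2 \in G ->
    f u1 = tperm a1 b1 * tperm c1 d1 -> f u2 = tperm a2 b2 * tperm c2 d2 ->
  (u1 * u2) ^+ 2 = 1.
Proof.
move=> U Gu1 Gu2 f1 f2; have U1 := subseq_uniq (take_subseq _ 4) U.
move: U; rewrite /= !inE !negb_or -!andbA => U.
do ![case/andP: U => ? U].
have C12 : commute u1 u2.
  by apply: (commute_lift_tperm2 Gu1 Gu2 U1 f1); rewrite f2 permM !tpermD; neq.
(* Four transpositions make [k] even, so it has a lift to [G]. *)
pose k : {perm T} := (tperm a1 a2 * tperm b1 b2) * (tperm c1 c2 * tperm d1 d2).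
have [w Gw fw] : exists2 w, w \in G & f w = k.
  by apply: lift; rewrite groupM ?tperm2_Alt; neq.
have Ek : f (u1 ^ w) = f u2.
  rewrite morphJ // fw f1 f2 conjMg !tpermJ.
  have -> : k a1 = a2 by rewrite !permM tpermL !tpermD; neq.
  have -> : k b1 = b2 by rewrite !permM (tpermD (z := b1)) ?tpermL ?tpermD; neq.
  have -> : k c1 = c2.
    rewrite !permM [tperm a1 a2 _]tpermD; neq; rewrite [tperm b1 b2 _]tpermD; neq.
    by rewrite tpermL tpermD; neq.
  have -> // : k d1 = d2.
  rewrite !permM [tperm a1 a2 _]tpermD; neq; rewrite [tperm b1 b2 _]tpermD; neq.
  by rewrite [tperm c1 c2 _]tpermD; neq; rewrite tpermL.
have [z [Gz fz Eu]] := same_lift (groupJ Gu1 Gw) Gu2 Ek.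
have fu1 : f (u1 ^+ 2) = 1.
  have Ct : commute (tperm a1 b1) (tperm c1 d1).
    by rewrite /commute conjgC tpermJ !tpermD; neq.
  by rewrite morphX // f1 expgMn // !expg2 !tperm2 mulg1.
rewrite expgMn //; have -> : u2 ^+ 2 = u1 ^+ 2.
  have [Gs Cs] := (groupX 2 Gu1, ker_central (groupX 2 Gu1) Gw fu1).
  have : (u1 ^ w) ^+ 2 = (u2 * z) ^+ 2 by rewrite Eu.
  rewrite -conjXg conjgE Cs mulKg (expgMn 2 (commute_sym (ker_central Gz Gu2 fz))).
  by rewrite (ker_sqr Gz fz) mulg1.
by rewrite -expg2; apply: ker_sqr (groupX 2 Gu1) fu1.
Qed.

(** Four transpositions, moving eight points, are peeled off at each induction step. Their lift
    squares to 1 and commutes with the lift of the rest. *)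
Lemma lift_involution p u k : u \in G -> f u = p -> involutive p ->
  #|moved p| = (8 * k)%N -> u ^+ 2 = 1.
Proof.
elim: k p u => [|k IH] p u Gu fu pK mp.
  apply: ker_sqr => //; rewrite fu; apply/permP=> q; rewrite perm1; apply/eqP.
  move/eqP: mp; rewrite muln0 cards_eq0 => /eqP/setP/(_ q).
  by rewrite !inE => /negbFE.
have Ap : p \in 'Alt_T by rewrite -imf -fu mem_morphim.
rewrite mulnS in mp.
have [|a1 [b1 [p1 [ab1 E1 p1K [p1a p1b] [m1 fx1]]]]] := peel_transposition pK.
  by rewrite mp.
rewrite {}m1 in mp; case: mp => mp.
have [|c1 [d1 [p2 [cd1 E2 p2K [p2c p2d] [m2 fx2]]]]] := peel_transposition p1K.
  by rewrite mp.
rewrite {}m2 in mp; case: mp => mp.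
have [|a2 [b2 [p3 [ab2 E3 p3K [p3a p3b] [m3 fx3]]]]] := peel_transposition p2K.
  by rewrite mp.
rewrite {}m3 in mp; case: mp => mp.
have [|c2 [d2 [p4 [cd2 E4 p4K [p4c p4d] [m4 fx4]]]]] := peel_transposition p3K.
  by rewrite mp.
rewrite {}m4 in mp; case: mp => mp.
have [ca da p2a] := fx2 _ p1a; have [cb db p2b] := fx2 _ p1b.
have [aa ba p3a1] := fx3 _ p2a; have [ab bb p3b1] := fx3 _ p2b.
have [ac bc p3c1] := fx3 _ p2c; have [ad bd p3d1] := fx3 _ p2d.
have [e1 e2 p4a1] := fx4 _ p3a1; have [e3 e4 p4b1] := fx4 _ p3b1.
have [e5 e6 p4c1] := fx4 _ p3c1; have [e7 e8 p4d1] := fx4 _ p3d1.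
have [e9 e10 p4a2] := fx4 _ p3a; have [e11 e12 p4b2] := fx4 _ p3b.
have A1 := tperm2_Alt ab1 cd1; have A2 := tperm2_Alt ab2 cd2.
have Ep : p = (tperm a1 b1 * tperm c1 d1) * (tperm a2 b2 * tperm c2 d2) * p4.
  by rewrite E1 E2 E3 E4 !mulgA.
have A12 := groupM A1 A2.
have A4 : p4 \in 'Alt_T by move: Ap; rewrite Ep (groupMl _ A12).
have [u1 Gu1 f1] := lift A1; have [u2 Gu2 f2] := lift A2.
have [u4 Gu4 f4] := lift A4.
have G12 : u1 * u2 \in G by rewrite groupM.
have [|z [Gz fz ->]] := same_lift Gu (groupM G12 Gu4).
  by rewrite fu Ep !morphM // f1 f2 f4.
have U : uniq [:: a1; b1; c1; d1; a2; b2; c2; d2].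
  by rewrite /= !inE !negb_or -!andbA; do ![apply/andP; split]; neq.
have s12 : (u1 * u2) ^+ 2 = 1 by apply: (lift_tperm4 U).
have s4 : u4 ^+ 2 = 1 by apply: (IH _ _ Gu4 f4 p4K).
have C1 : commute u1 u4.
  apply: (commute_lift_tperm2 Gu1 Gu4 (subseq_uniq (take_subseq _ 4) U) f1);
  by rewrite f4.
have C2 : commute u2 u4.
  apply: (commute_lift_tperm2 Gu2 Gu4 (subseq_uniq (drop_subseq _ 4) U) f2);
  by rewrite f4.
rewrite expgMn; last by apply/commute_sym/ker_central; rewrite ?groupM.
rewrite expgMn; last by apply/commute_sym/commuteM; apply: commute_sym.
by rewrite s12 s4 ker_sqr // !mulg1.
Qed.

Hypothesis iota_der : iota \in G^`(1).

(** Every element of [G] is an element of [H] times a central one, so every commutator of [G] is a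
    commutator of elements of [H]. Hence [H] contains the derived subgroup, in particular [iota],
    and therefore the whole kernel. *)
Lemma eq_of_morphim_onto (H : {group gT}) :
  H \subset G -> 'Alt_T \subset f @* H -> H :=: G.
Proof.
move=> sHG sAH; apply/eqP; rewrite eqEsubset sHG /=.
have dec u : u \in G -> exists h z, [/\ h \in H, z \in G, f z = 1 & u = h * z].
  move=> Gu; have : f u \in f @* H.
    by apply: (subsetP sAH); rewrite -imf mem_morphim.
  case/morphimP=> h Gh Hh e; have [z [Gz fz E]] := same_lift Gu Gh e.
  by exists h, z.
have sG'H : G^`(1) \subset H.
  rewrite gen_subG; apply/subsetP=> _ /imset2P[u v Gu Gv ->].
  have [h [z [Hh Gz fz Eu]]] := dec u Gu.
  have [k [t [Hk Gt ft Ev]]] := dec v Gv.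
  have Gh := subsetP sHG _ Hh; have Gk := subsetP sHG _ Hk.
  suff -> : [~ u, v] = [~ h, k] by rewrite groupR.
  have Cz w : w \in G -> commute z w by move=> Gw; apply: ker_central.
  have Ct w : w \in G -> commute t w by move=> Gw; apply: ker_central.
  have -> : [~ u, v] = [~ h, v].
    have zv : [~ z, v] = 1 by apply/eqP/commgP/Cz.
    by rewrite Eu commMgJ zv mulg1 conjgE -(Cz _ (groupR Gh Gv)) mulKg.
  have ht : [~ h, t] = 1 by apply/eqP/commgP/commute_sym/Ct.
  by rewrite Ev commgMJ ht mul1g conjgE -(Ct _ (groupR Gh Gk)) mulKg.
have Hiota := subsetP sG'H _ iota_der.
apply/subsetP=> u /dec[h [z [Hh Gz fz ->]]]; rewrite groupM //.
by case: (kerP Gz fz) => ->; rewrite ?group1.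
Qed.

(** Both lifts of [x] square to 1. The lift of [y] is chosen to have order 3, and then the lift of
    [x] is chosen to make the product have order 7. *)
Lemma hurwitz_lift (x y : {perm T}) k :
    involutive x -> x != 1 -> y ^+ 3 = 1 -> y != 1 ->
    (x * y) ^+ 7 = 1 -> x * y != 1 ->
    'Alt_T \subset <<[set x; y]>> -> #|moved x| = (8 * k)%N ->
  exists X Y Z, [/\ hurwitz_triple G X Y Z,
    f X = x, f Y = y & f Z = (x * y)^-1].
Proof.
move=> xK nx y3 ny xy7 nxy sA mx.
(* A permutation of odd order is a square, hence even. *)
have odd_Alt (p : {perm T}) j : p ^+ j.*2.+1 = 1 -> p \in 'Alt_T.
  move=> pj; suff -> : p = p ^+ j.+1 * p ^+ j.+1 by rewrite Alt_even odd_permM addbb.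
  by rewrite -expgD addnn doubleS expgS pj mulg1.
have Ay : y \in 'Alt_T by apply: (odd_Alt _ 1%N).
have Axy : x * y \in 'Alt_T by apply: (odd_Alt _ 3%N).
have Ax : x \in 'Alt_T by rewrite -(groupMr _ Ay).
have [X0 GX0 fX0] := lift Ax; have [Y0 GY0 fY0] := lift Ay.
have X02 := lift_involution GX0 fX0 xK mx.
(* $Y_0^3$ lies in the kernel, so $Y_0^{12}=1$, while $Y_0^4$ still maps to $y^4=y$. *)
pose Y := Y0 ^+ 4; have GY : Y \in G by rewrite groupX.
have fY : f Y = y by rewrite morphX // fY0 expgS y3 mulg1.
have Y3 : Y ^+ 3 = 1.
  have f3 : f (Y0 ^+ 3) = 1 by rewrite morphX // fY0.
  have -> : Y ^+ 3 = Y0 ^+ 3 ^+ 2 ^+ 2 by rewrite -!expgM.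
  by rewrite (ker_sqr (groupX 3 GY0) f3) expg1n.
(* $c$ is central with $c^2=1$, so replacing $X_0$ by $cX_0$ turns the seventh power into
   $c^7c=c^8=1$. *)
pose c := (X0 * Y) ^+ 7; have GW : X0 * Y \in G by rewrite groupM.
have Gc : c \in G by rewrite groupX.
have fc : f c = 1 by rewrite morphX // morphM // fX0 fY.
have c2 := ker_sqr Gc fc; pose X := c * X0.
have GX : X \in G by rewrite groupM.
have fX : f X = x by rewrite morphM // fc mul1g.
have X2 : X ^+ 2 = 1 by rewrite expgMn ?X02 ?c2 ?mulg1 //; apply: ker_central.
have XY7 : (X * Y) ^+ 7 = 1.
  rewrite -mulgA expgMn; last by apply: ker_central.
  by rewrite -/c -expgSr (expgM c 2 4) c2 expg1n.
have GXY : X * Y \in G by rewrite groupM.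
have fXY : f (X * Y) = x * y by rewrite morphM // fX fY.
have ord (u : gT) p : prime p -> u \in G -> u ^+ p = 1 -> f u != 1 -> #[u] = p.
  move=> pp Gu up fu; apply: nt_prime_order => //.
  by apply: contraNneq fu => ->; rewrite morph1.
exists X, Y, (X * Y)^-1; split=> //; last by rewrite morphV // fXY.
split; rewrite ?groupV ?mulgV //.
  split; [|by apply: ord; rewrite ?fY|by rewrite orderV; apply: ord; rewrite ?fXY].
  by apply: ord; rewrite ?fX.
apply: (@eq_of_morphim_onto <<[set X; Y; (X * Y)^-1]>>%G).
  rewrite gen_subG; apply/subsetP=> u; rewrite !inE.
  by case/orP=> [/orP[]|] /eqP->; rewrite ?groupV.
apply: subset_trans sA _; rewrite gen_subG; apply/subsetP=> p.
by rewrite !inE => /orP[]/eqP->; rewrite -?fX -?fY mem_morphim // mem_gen // !inE eqxx ?orbT.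
Qed.

End Lifting.

(** * From pairs of permutations to the Beauville property *)

Lemma prime_order_expg (gT : finGroupType) (u : gT) i : prime #[u] -> u ^+ i != 1 ->
  #[u ^+ i] = #[u] /\ exists j, u ^+ i ^+ j = u.
Proof.
move=> pu nui; have oi : #[u ^+ i] = #[u].
  by apply: nt_prime_order => //; rewrite -expgM mulnC expgM expg_order expg1n.
split=> //; have : u \in <[u ^+ i]>.
  have -> : <[u ^+ i]> = <[u]> by apply/eqP; rewrite eqEcard cycleX /= -!orderE oi.
  exact: cycle_id.
by case/cycleP=> j Ej; exists j.
Qed.

(** As 2, 3 and 7 are prime, the relations and nontriviality give the exact orders. The last clause
    makes [x] lift to an involution. *)
Definition triple_in_Alt (T : finType) (x y : {perm T}) :=
  [/\ [/\ involutive x, y ^+ 3 = 1 & (x * y) ^+ 7 = 1],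
      [/\ x != 1, y != 1 & x * y != 1],
      'Alt_T \subset <<[set x; y]>>
    & 8 %| #|moved x|].

(** A nontrivial power of a generator has the prime order of that generator, so only generators of
    equal order can have conjugate nontrivial powers. The image of such a power fixes as many points
    as the image of the generator, and conjugation preserves this number. *)
Lemma beauville_of_triples (gT : finGroupType) (G : {group gT}) (iota : gT)
    (T : finType) (f : {morphism G >-> {perm T}}) (x1 y1 x2 y2 : {perm T}) :
    iota \in 'Z(G) -> #[iota] = 2 -> iota \in G^`(1) ->
    'ker f = <[iota]> -> f @* G = 'Alt_T ->
    triple_in_Alt x1 y1 -> triple_in_Alt x2 y2 ->
    [/\ nfix x1 != nfix x2, nfix y1 != nfix y2 & nfix (x1 * y1) != nfix (x2 * y2)] ->
  doubly_hurwitz_beauville G.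
Proof.
move=> Zi i2 di kf imf [[xK1 y31 xy71] [nx1 ny1 nxy1] sA1 /dvdnP[k1]].
rewrite mulnC => m1 [[xK2 y32 xy72] [nx2 ny2 nxy2] sA2 /dvdnP[k2]].
rewrite mulnC => m2 [dx dy dz].
have [X1 [Y1 [Z1 [H1 fX1 fY1 fZ1]]]] :=
  hurwitz_lift Zi i2 kf imf di xK1 nx1 y31 ny1 xy71 nxy1 sA1 m1.
have [X2 [Y2 [Z2 [H2 fX2 fY2 fZ2]]]] :=
  hurwitz_lift Zi i2 kf imf di xK2 nx2 y32 ny2 xy72 nxy2 sA2 m2.
have nfixV (T' : finType) (p : {perm T'}) : nfix p^-1 = nfix p.
  apply: eq_card => q; rewrite !inE; apply/eqP/eqP => e.
    by rewrite -{1}e permKV.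
  by rewrite -{1}e permK.
exists X1, Y1, Z1, X2, Y2, Z2; split=> // u v i j Su Sv nui.
apply/negP=> /imsetP[g Gg e].
have [[GX1 GY1 GZ1] [oX1 oY1 oZ1] _ _] := H1.
have [[GX2 GY2 GZ2] [oX2 oY2 oZ2] _ _] := H2.
have key (p : nat) : prime p -> #[u] = p -> #[v] = p -> u \in G -> v \in G ->
    nfix (f u) = nfix (f v).
  move=> pp ou ov Gu Gv.
  have [|oui [k Ek]] := @prime_order_expg _ u i _ nui; first by rewrite ou.
  have nvj : v ^+ j != 1 by rewrite e -(inj_eq (@conjg_inj _ g^-1)) conjgK conj1g.
  have [|ovj [l El]] := @prime_order_expg _ v j _ nvj; first by rewrite ov.
  rewrite -(nfix_expg (p := f u) (i := i) (j := k)); last by rewrite -!morphX ?groupX ?Ek.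
  rewrite -(nfix_expg (p := f v) (i := j) (j := l)); last by rewrite -!morphX ?groupX ?El.
  by rewrite -!morphX // e morphJ ?groupX // nfixJ.
have nvj : v ^+ j != 1 by rewrite e -(inj_eq (@conjg_inj _ g^-1)) conjgK conj1g.
have oe : #[v ^+ j] = #[u ^+ i] by rewrite e orderJ.
have pu : prime #[u] by move: Su; rewrite !inE => /orP[/orP[]|]/eqP->; rewrite ?oX1 ?oY1 ?oZ1.
have pv : prime #[v] by move: Sv; rewrite !inE => /orP[/orP[]|]/eqP->; rewrite ?oX2 ?oY2 ?oZ2.
have [eu _] := prime_order_expg pu nui; have [ev _] := prime_order_expg pv nvj.
move: oe; rewrite eu ev; move: Su Sv key; rewrite !inE.
case/orP=> [/orP[]|]/eqP->; case/orP=> [/orP[]|]/eqP->;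
  rewrite ?oX1 ?oY1 ?oZ1 ?oX2 ?oY2 ?oZ2 // => key _.
- by have := key 2 isT erefl erefl GX1 GX2; rewrite fX1 fX2 => /eqP; rewrite (negPf dx).
- by have := key 3 isT erefl erefl GY1 GY2; rewrite fY1 fY2 => /eqP; rewrite (negPf dy).
have := key 7 isT erefl erefl GZ1 GZ2; rewrite fZ1 fZ2 !nfixV => /eqP.
by rewrite (negPf dz).
Qed.

(** Chains act on a type of pairs, whereas the cover is given over permutations of ['I_n]. The
    triple is carried along a bijection. Parity survives because transpositions go to
    transpositions. *)
Lemma transport_triple (T T' : finType) (x y : {perm T}) :
    #|T| = #|T'| -> triple_in_Alt x y ->
  exists x' y' : {perm T'}, [/\ triple_in_Alt x' y', nfix x' = nfix x,
    nfix y' = nfix y & nfix (x' * y') = nfix (x * y)].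
Proof.
move=> e; pose f (x : T) : T' := enum_val (cast_ord e (enum_rank x)).
pose f' (x : T') : T := enum_val (cast_ord (esym e) (enum_rank x)).
have fK : cancel f f' by move=> z; rewrite /f /f' enum_valK cast_ordK enum_rankK.
have f'K : cancel f' f by move=> z; rewrite /f /f' enum_valK cast_ordKV enum_rankK.
have fI := can_inj fK.
have inj (p : {perm T}) : injective (f \o p \o f').
  by apply: inj_comp (can_inj f'K); apply: inj_comp fI perm_inj.
pose h (p : {perm T}) := perm (inj p).
have hE p z : h p (f z) = f (p z) by rewrite permE /= fK.
have hM : {in setT &, {morph h : p q / p * q}}.
  by move=> p q _ _; apply/permP=> z; rewrite -(f'K z) permM !hE permM.
pose hm := Morphism hM.
have hI p q : h p = h q -> p = q.
  by move=> epq; apply/permP=> z; apply: fI; rewrite -!hE epq.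
have h1 : h 1 = 1 := morph1 hm.
have hMs p q : h (p * q) = h p * h q by rewrite hM ?inE.
have hX p n : h (p ^+ n) = h p ^+ n := morphX hm n (in_setT p).
have hT z t : h (tperm z t) = tperm (f z) (f t).
  apply/permP=> s; rewrite -(f'K s) hE; set u := f' s.
  case: tpermP => [->|->|/eqP uz /eqP ut]; rewrite ?tpermL ?tpermR //.
  by rewrite tpermD // (inj_eq fI) eq_sym.
have odd_h p : odd_perm (h p) = odd_perm p.
  case: (prod_tpermP p) => ts -> _.
  elim: ts => [|[z t] ts IH]; first by rewrite !big_nil h1 !odd_perm1.
  rewrite !big_cons odd_permM odd_tperm -IH /=.
  by rewrite hMs odd_permM hT odd_tperm (inj_eq fI).
have nfix_h p : nfix (h p) = nfix p.
  rewrite /nfix -[RHS](card_imset _ fI); apply: eq_card => z; rewrite -(f'K z).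
  by rewrite inE hE (inj_eq fI) mem_imset // inE.
have moved_h p : #|moved (h p)| = #|moved p|.
  rewrite -[RHS](card_imset _ fI); apply: eq_card => z; rewrite -(f'K z).
  by rewrite inE hE (inj_eq fI) mem_imset // inE.
case=> [[xK y3 xy7] [nx ny nxy] sA m8].
have h_neq1 p : p != 1 -> h p != 1.
  by apply: contraNneq => hp; apply/eqP/hI; rewrite hp h1.
exists (h x), (h y); rewrite -hMs !nfix_h; split=> //; split.
- split; [|by rewrite -hX y3|by rewrite -hMs -hX xy7].
  by move=> z; rewrite -(f'K z) !hE xK.
- by rewrite -hMs !h_neq1.
- apply/subsetP=> q Aq.
  have inj' : injective (f' \o q \o f).
    by apply: inj_comp fI; apply: inj_comp (can_inj f'K) perm_inj.
  have Eq : q = h (perm inj').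
    by apply/permP=> z; rewrite -(f'K z) hE permE /= !f'K.
  have Ap : perm inj' \in <<[set x; y]>>.
    by apply: (subsetP sA); rewrite Alt_even -odd_h -Eq -Alt_even.
  have : h (perm inj') \in hm @* <<[set x; y]>> by apply: mem_morphim; rewrite ?inE.
  rewrite -Eq morphim_gen ?subsetT //; apply: subsetP; apply: genS.
  apply/subsetP=> _ /morphimP[p _ + ->]; rewrite !inE.
  by case/orP=> /eqP-> /=; rewrite eqxx ?orbT.
by rewrite moved_h.
Qed.

Lemma cover_morphism (gT : finGroupType) (G : {group gT}) (T : finType) (iota : gT) :
    iota \in 'Z(G) -> G / <[iota]> \isog 'Alt_T ->
  exists f : {morphism G >-> {perm T}}, 'ker f = <[iota]> /\ f @* G = 'Alt_T.
Proof.
move=> Zi /isogP[phi injphi im]; have Gi : iota \in G by case/setIP: Zi.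
have sZG : <[iota]> \subset G by rewrite cycle_subG.
have nZ : G \subset 'N(<[iota]>).
  apply/cents_norm; rewrite centsC cycle_subG; by case/setIP: Zi.
pose f0 u := phi (coset <[iota]> u).
have fM : {in G &, {morph f0 : u v / u * v}}.
  move=> u v Gu Gv; rewrite /f0 morphM ?(subsetP nZ) //.
  by rewrite morphM ?mem_quotient.
exists (Morphism fM); split.
  apply/setP=> u; apply/idP/idP=> [/morphpreP[Gu /set1P /= fu]|Zu].
    apply: coset_idr; first exact: (subsetP nZ).
    by apply/eqP; rewrite -(morph_injm_eq1 injphi) ?mem_quotient //; apply/eqP.
  have Gu := subsetP sZG _ Zu; apply/kerP => //=.
  by rewrite /f0 coset_id // morph1.
rewrite -im; apply/setP=> p; apply/morphimP/morphimP=> [[u _ Gu ->]|[w _ Gw ->]].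
  by exists (coset <[iota]> u); rewrite ?mem_quotient.
case/morphimP: Gw => u Nu Gu ->; by exists u.
Qed.

Local Close Scope group_scope.

(** * Chains of coset diagrams *)

(* A coset diagram: [y] rotates the triples (3k, 3k+1, 3k+2) for k < [ntri]
   and fixes the other points, and [x] is the list of images [xs].  The left
   handle is at 0, 1 and the right handle at 3, 4.  For a head, [core] lists
   the 17-cycle of [x y x y^-1] and [cword] is a word moving it off itself
   except for one point. *)
Record piece := Piece {
  has_left : bool; has_right : bool; ntri : nat;
  core : seq nat; cword : seq nat; xs : seq nat }.

Definition psize P := size (xs P).
Definition px P v := nth 0 (xs P) v.
Definition py P v :=
  if v < 3 * ntri P then if v %% 3 == 2 then v - 2 else v.+1 else v.
Definition in_left P v := has_left P && (v < 2).
Definition in_right P v := has_right P && (2 < v < 5).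

Definition nopiece := Piece false false 0 [::] [::] [::].

(** Handles are joined in order: points 3 and 4 of a diagram with points 0 and 1 of the next one,
    hence the shifts by 3. *)
Definition xstep (L : seq piece) (p : nat * nat) :=
  let P := nth nopiece L p.1 in
  if in_right P p.2 then (p.1.+1, p.2 - 3)
  else if in_left P p.2 then (p.1.-1, p.2 + 3) else (p.1, px P p.2).
Definition ystep (L : seq piece) (p : nat * nat) :=
  (p.1, py (nth nopiece L p.1) p.2).
(* The word [e1; e2; ...] stands for x y^e1 x y^e2 ... *)
Fixpoint run L w p :=
  if w is e :: w' then run L w' (iter e (ystep L) (xstep L p)) else p.

(* [run] in the two-piece chain P Q, aborted when it leaves through an outer
   handle, so that the result is valid in any chain where Q follows P. *)
Definition pair_run P Q : seq nat -> nat * nat -> option (nat * nat) :=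
  fix loop w p :=
    if w is e :: w' then
      if (if p.1 == 0 then in_left P p.2 else in_right Q p.2) then None
      else loop w' (iter e (ystep [:: P; Q]) (xstep [:: P; Q] p))
    else Some p.
(** [k] counts the iterations already made. Started with [p = p0] and [k = 0], the test [ok] is
    applied to the exact length of the cycle of [p0]. *)
Fixpoint returns P Q w (ok : pred nat) p0 p k fuel :=
  if pair_run P Q w p is Some p' then
    if p' == p0 then ok k.+1
    else if fuel is f.+1 then returns P Q w ok p0 p' k.+1 f else false
  else false.

(* A heuristic without soundness requirement: it only selects the
   neighbour with which the cycle of [v] is traced. *)
Definition toward_left P w v :=
  has_left P &&
  (~~ has_right P ||
   (fix loop fuel v :=
      if fuel is f.+1 then
        (fix go w' v :=
           if w' is e :: w'' then
             if v < 2 then true else if 2 < v < 5 then false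
             else go w'' (iter e (py P) (px P v))
           else loop f v) w v
      else false) 40 v).

(** The word $xyxy^2$, which is $w=xyxy^{-1}$ since $y^3=1$. *)
Definition commw := [:: 1; 2].

Definition fuel := 60.
(** Each diagram of a chain is the first member of one pair, the second member of another, or both.
    A point is checked in exactly one of its two roles, selected by [toward_left]; the core is
    exempt for [commw]. *)
Definition traced P Q w ok :=
  all (fun v => toward_left P w v || (v \in core P) && (w == commw) ||
         returns P Q w ok (0, v) (0, v) 0 fuel) (iota 0 (psize P)) &&
  all (fun v => ~~ toward_left Q w v ||
         returns P Q w ok (1, v) (1, v) 0 fuel) (iota 0 (psize Q)).
Definition joinable P Q :=
  [&& has_right P, has_left Q,
      traced P Q [:: 1] (fun k => k %| 7)
    & traced P Q commw (fun k => ~~ (17 %| k))].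

Definition good_piece P :=
  let r := iota 0 (psize P) in
  [&& 3 * ntri P <= psize P,
      all (fun v => (px P v < psize P) && (px P (px P v) == v)) r,
      has_left P ==> [&& px P 0 == 0, px P 1 == 1 & 0 < ntri P] &
      has_right P ==> [&& px P 3 == 3, px P 4 == 4 & 1 < ntri P]].

Definition sweep P s := undup (s ++ map (px P) s ++ map (py P) s).
Definition swept_by P r m :=
  let s := iter m (sweep P) [:: r] in
  all (fun v => v \in s) (iota 0 (psize P)).
(** Forty rounds suffice for each of the diagrams used below. *)
Definition connected_from P r := swept_by P r 40.

(** Handle points are fixed by [px] but moved by x in the chain, so they are excluded. *)
Definition fixed_x P :=
  count (fun v => [&& ~~ in_right P v, ~~ in_left P v & px P v == v])
    (iota 0 (psize P)).
Definition fixed_y P := count (fun v => py P v == v) (iota 0 (psize P)).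
Definition fixed_xy P :=
  count (fun v => [&& ~~ in_right P v, ~~ in_left P v & py P (px P v) == v])
    (iota 0 (psize P)).

(** The two [has] clauses provide core points whose image under x, respectively y, is again in the
    core; this will make the class of the core stable. The last two clauses say that [cword] takes
    exactly one core point back into the core. *)
Definition good_head P Q :=
  let S := core P in
  [&& ~~ has_left P, size S == 17, uniq S, connected_from P (head 0 S),
      all (fun v => v < psize P) S,
      [seq pair_run P Q commw (0, v) | v <- S] ==
      [seq Some (0, v) | v <- seq.rot 1 S],
      has (fun v => ~~ in_right P v && (px P v \in S)) S,
      has (fun v => py P v \in S) S,
      all (fun v => pair_run P Q (cword P) (0, v) != None) S &
      count (fun v => if pair_run P Q (cword P) (0, v) is Some p
         then (p.1 == 0) && (p.2 \in S) else false) S == 1].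


Lemma py_lt P v : 3 * ntri P <= psize P -> v < psize P -> py P v < psize P.
Proof. by rewrite /py; case: ifP => //; case: ifP; lia. Qed.

Lemma py3 P v : py P (py P (py P v)) = v.
Proof.
rewrite /py; have [tv|/negPf tv] := boolP (v < 3 * ntri P); last by rewrite !tv.
have [v3|v3] := eqVneq (v %% 3) 2.
  have -> : v - 2 < 3 * ntri P by lia.
  have -> : (v - 2) %% 3 == 2 = false by lia.
  have -> : (v - 2).+1 < 3 * ntri P by lia.
  have -> : (v - 2).+1 %% 3 == 2 = false by lia.
  lia.
have -> : v.+1 < 3 * ntri P by lia.
have [v3'|v3'] := eqVneq (v.+1 %% 3) 2.
  have -> : v.+1 - 2 < 3 * ntri P by lia.
  have -> : (v.+1 - 2) %% 3 == 2 = false by lia.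
  lia.
have -> : v.+2 < 3 * ntri P by lia.
have -> : v.+2 %% 3 == 2 by lia.
lia.
Qed.

(** * The permutations x and y of a chain *)

Section Chain.

Variable L : seq piece.
Local Notation pc i := (nth nopiece L i).
Hypothesis good_L : all good_piece L.
Hypothesis left_L : forall i, i < size L -> has_left (pc i) = (0 < i).
Hypothesis right_L : forall i, i < size L -> has_right (pc i) = (i.+1 < size L).

Let goodP i : i < size L -> [/\ 3 * ntri (pc i) <= psize (pc i),
   forall v, v < psize (pc i) -> px (pc i) v < psize (pc i) /\ px (pc i) (px (pc i) v) = v,
   0 < i -> [/\ px (pc i) 0 = 0, px (pc i) 1 = 1 & 0 < ntri (pc i)] &
   i.+1 < size L -> [/\ px (pc i) 3 = 3, px (pc i) 4 = 4 & 1 < ntri (pc i)]].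
Proof.
move=> iL; have := all_nthP nopiece good_L i iL.
case/and4P=> t3 /allP pxP; rewrite left_L // right_L // => /implyP hl /implyP hr.
split=> //.
- move=> v vP; have := pxP v; rewrite mem_iota => /(_ vP)/andP[-> /eqP->] //.
- by move/hl => /and3P[/eqP ? /eqP ? ?].
by move/hr => /and3P[/eqP ? /eqP ? ?].
Qed.

Definition points := [seq (i, v) | i <- iota 0 (size L), v <- iota 0 (psize (pc i))].

Lemma mem_points p : (p \in points) = (p.1 < size L) && (p.2 < psize (pc p.1)).
Proof.
apply/allpairsPdep/andP => [[i [v [iL vP ->]]] /=|[iL vP]].
  by move: iL vP; rewrite !mem_iota.
by exists p.1, p.2; rewrite !mem_iota; split=> //; case: p {iL vP}.
Qed.

Lemma uniq_points : uniq points.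
Proof.
apply: allpairs_uniq_dep; first exact: iota_uniq.
  by move=> i _; apply: iota_uniq.
move=> [i v] [j u] _ _ /= [-> ->] //.
Qed.

Lemma ystep_points p : p \in points -> ystep L p \in points.
Proof.
by rewrite !mem_points /= => /andP[iL vP]; rewrite iL py_lt //; case: (goodP iL).
Qed.

Lemma ystep3 p : iter 3 (ystep L) p = p.
Proof. by case: p => i v; rewrite /ystep /= py3. Qed.

Lemma xstep_right i v : i.+1 < size L -> 2 < v < 5 -> xstep L (i, v) = (i.+1, v - 3).
Proof.
by move=> iL v34; rewrite /xstep /in_right /= right_L ?iL ?v34 //; apply: ltnW.
Qed.

Lemma xstep_left i v : i.+1 < size L -> v < 2 -> xstep L (i.+1, v) = (i, v + 3).
Proof.
move=> iL v01; rewrite /xstep /in_right /in_left; set b := 2 < _ < 5.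
by have -> : b = false; [rewrite /b /=; lia|rewrite andbF /= left_L // v01].
Qed.

Lemma xstep_inner i v : ~~ in_right (pc i) v -> ~~ in_left (pc i) v ->
  xstep L (i, v) = (i, px (pc i) v).
Proof. by rewrite /xstep /= => /negPf-> /negPf->. Qed.

Variant xstep_spec i v : bool -> bool -> nat * nat -> Type :=
| XRight of i.+1 < size L & 2 < v < 5 : xstep_spec i v true false (i.+1, v - 3)
| XLeft j of i = j.+1 & v < 2 : xstep_spec i v false true (j, v + 3)
| XInner of ~~ in_right (pc i) v & ~~ in_left (pc i) v
  & px (pc i) v < psize (pc i) & px (pc i) (px (pc i) v) = v :
    xstep_spec i v false false (i, px (pc i) v).

Lemma xstepP i v : (i, v) \in points ->
  xstep_spec i v (in_right (pc i) v) (in_left (pc i) v) (xstep L (i, v)).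
Proof.
rewrite mem_points /= => /andP[iL vP].
case er: (in_right _ v).
  move: er => /andP[]; rewrite right_L // => iL' v34; rewrite xstep_right //.
  have -> : in_left (pc i) v = false by rewrite /in_left andbC; case: ltnP => //; lia.
  by constructor.
case el: (in_left _ v).
  move: el => /andP[]; rewrite left_L //; case: i iL {vP er} => // i iL _ v01.
  by rewrite xstep_left //; constructor.
rewrite xstep_inner ?er ?el //; have [_ /(_ v vP)[? ?] _ _] := goodP iL.
by constructor; rewrite ?er ?el.
Qed.

Lemma xstep_points p : p \in points -> xstep L p \in points.
Proof.
case: p => i v pL; have := pL; rewrite mem_points /= => /andP[iL vP].
case: (xstepP pL) => [iL' v34|j ij v01|_ _ vP' _]; rewrite mem_points /= ?iL //.
- by rewrite iL' /=; have [? _ [//|_ _ ?] _] := goodP iL'; lia.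
have iL' : j < size L by lia.
by rewrite iL' /=; have [? _ _ [|_ _ ?]] := goodP iL'; lia.
Qed.

Lemma xstepK p : p \in points -> xstep L (xstep L p) = p.
Proof.
case: p => i v pL; have := pL; rewrite mem_points /= => /andP[iL vP].
have [_ _ hl hr] := goodP iL.
have qL := xstep_points pL; move: qL.
case: (xstepP pL) => [iL' v34|j ij v01|nr nl vP' pxx] qL.
- by rewrite xstep_left //; [congr pair|]; lia.
- by rewrite xstep_right -?ij //; [congr pair|]; lia.
(* An inner point is never sent to a handle point: the latter is fixed by the involution [px], so
   the two would coincide. *)
have fixed_contra w : px (pc i) w = w -> px (pc i) v = w -> v = w.
  by move=> pw e; rewrite -pxx e.
rewrite xstep_inner ?pxx //; [apply: contra nr|apply: contra nl]; case/andP.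
  rewrite /in_right right_L // => iL' h34; have [h3 h4 _] := hr iL'.
  rewrite iL'; suff: (v == 3) || (v == 4) by lia.
  have: (px (pc i) v == 3) || (px (pc i) v == 4) by lia.
  by case/orP=> /eqP e; rewrite (fixed_contra _ _ e).
rewrite /in_left left_L // => i0 h01; have [h0 h1 _] := hl i0.
rewrite i0; suff: (v == 0) || (v == 1) by lia.
have: (px (pc i) v == 0) || (px (pc i) v == 1) by lia.
by case/orP=> /eqP e; rewrite (fixed_contra _ _ e).
Qed.

Local Notation T := (seq_sub points).

(** The default value of [insubd] is never taken, because [xstep] preserves [points]. *)
Definition xfun (p : T) : T := insubd p (xstep L (val p)).
Definition yfun (p : T) : T := insubd p (ystep L (val p)).

Lemma val_xfun p : val (xfun p) = xstep L (val p).
Proof. by rewrite val_insubd xstep_points //; apply: valP. Qed.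
Lemma val_yfun p : val (yfun p) = ystep L (val p).
Proof. by rewrite val_insubd ystep_points //; apply: valP. Qed.

Lemma xfunK : involutive xfun.
Proof. by move=> p; apply: val_inj; rewrite !val_xfun xstepK //; apply: valP. Qed.
Lemma yfun3 p : yfun (yfun (yfun p)) = p.
Proof. by apply: val_inj; rewrite !val_yfun; apply: (ystep3 (val p)). Qed.

Lemma yfun_inj : injective yfun.
Proof. exact: (can_inj (g := yfun \o yfun) yfun3). Qed.

Definition xperm : {perm T} := perm (inv_inj xfunK).
Definition yperm : {perm T} := perm yfun_inj.
Lemma val_xperm p : val (xperm p) = xstep L (val p).
Proof. by rewrite permE val_xfun. Qed.
Lemma val_yperm p : val (yperm p) = ystep L (val p).
Proof. by rewrite permE val_yfun. Qed.

Fixpoint wperm w : {perm T} :=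
  (if w is e :: w' then xperm * yperm ^+ e * wperm w' else 1)%g.

Lemma val_wperm w p : val (wperm w p) = run L w (val p).
Proof.
elim: w p => [|e w IH] p /=; first by rewrite perm1.
rewrite !permM permX IH; congr run; elim: e => [|e IHe] /=; first exact: val_xperm.
by rewrite val_yperm IHe.
Qed.

Lemma val_wpermX w k p : val ((wperm w ^+ k)%g p) = iter k (run L w) (val p).
Proof. by rewrite permX; elim: k => // k IH; rewrite !iterS val_wperm IH. Qed.


(** * Cycles traced in two consecutive diagrams *)

Lemma pair_runE i P Q w b v b' v' : pc i = P -> pc i.+1 = Q -> b < 2 ->
  pair_run P Q w (b, v) = Some (b', v') ->
  b' < 2 /\ run L w (i + b, v) = (i + b', v').
Proof.
move=> iP iQ; elim: w b v => [|e w IH] b v b2 /=; first by case=> <- <-.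
case: ifP => // guard.
have [c [u [c2 E1 E2]]] : exists c u, [/\ c < 2,
    xstep [:: P; Q] (b, v) = (c, u) & xstep L (i + b, v) = (i + c, u)].
  case: b b2 guard => [|[|//]] _ /= guard; rewrite /xstep /= ?addn0 ?addn1 ?iP ?iQ guard.
    by case: ifP => _; [exists 1, (v - 3); rewrite addn1|exists 0, (px P v); rewrite addn0].
  by case: ifP => _; [exists 0, (v + 3); rewrite addn0|exists 1, (px Q v); rewrite addn1].
rewrite E1 E2.
have pcE : nth nopiece [:: P; Q] c = pc (i + c).
  by case: c c2 {E1 E2} => [|[|//]] _; rewrite /= ?addn0 ?addn1.
have iterE M j r : iter e (ystep M) (j, r) = (j, iter e (py (nth nopiece M j)) r).
  by elim: e => //= e ->.
by rewrite !iterE pcE; apply: IH.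
Qed.

Lemma returnsE i P Q w ok b0 v0 b v k fl : pc i = P -> pc i.+1 = Q -> b < 2 ->
  returns P Q w ok (b0, v0) (b, v) k fl ->
  exists j, [/\ 0 < j <= fl.+1, ok (k + j) &
    iter j (run L w) (i + b, v) = (i + b0, v0)].
Proof.
move=> iP iQ; elim: fl b v k => [|fl IH] b v k b2 /=;
  case e: (pair_run P Q w (b, v)) => [[b' v']|//];
  have [b2' er] := pair_runE iP iQ b2 e; case: eqP => [[eb ev] okk|_] //.
- by exists 1; rewrite addn1 /= er eb ev.
- by exists 1; rewrite addn1 /= er eb ev.
case/(IH _ _ _ b2') => j [j1 okj ej]; exists j.+1; rewrite addnS -addSn.
by rewrite iterSr er ej; split=> //; lia.
Qed.

Hypothesis size_L : 1 < size L.
Hypothesis joinable_L : forall i, i.+1 < size L -> joinable (pc i) (pc i.+1).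

(** Points of the head are never [toward_left], and points of the last diagram always are, so the
    neighbour used for tracing exists. The bound on [j] is what makes a common exponent possible. *)
Lemma tracedE w ok i v : (forall j, j.+1 < size L -> traced (pc j) (pc j.+1) w ok) ->
  (i, v) \in points -> ~~ ((v \in core (pc i)) && (w == commw)) ->
  exists j, [/\ 0 < j <= fuel.+1, ok j & iter j (run L w) (i, v) = (i, v)].
Proof.
move=> tr; rewrite mem_points /= => /andP[iL vP] nc.
have vi k : v < psize (pc k) -> v \in iota 0 (psize (pc k)) by rewrite mem_iota.
have [tl|ntl] := boolP (toward_left (pc i) w v).
  have i0 : 0 < i by move: tl; rewrite /toward_left left_L // => /andP[].
  case: i iL vP nc tl i0 => // i iL vP nc tl _.
  have /andP[_ /allP/(_ _ (vi _ vP))] := tr i iL; rewrite tl => /orP[//|R].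
  have [j] := returnsE (b := 1) (i := i) erefl erefl isT R.
  by rewrite add0n addn1 => ?; exists j.
have iL' : i.+1 < size L.
  by rewrite ltnNge; apply: contra ntl => Li; rewrite /toward_left left_L // right_L //; lia.
have /andP[/allP/(_ _ (vi _ vP)) + _] := tr i iL'.
rewrite (negPf ntl) (negPf nc) => /orP[//|R].
have [j] := returnsE (b := 0) (i := i) erefl erefl isT R.
by rewrite add0n addn0 => ?; exists j.
Qed.

Lemma xyperm7 : ((xperm * yperm) ^+ 7 = 1)%g.
Proof.
have -> : (xperm * yperm)%g = wperm [:: 1] by rewrite /= expg1 mulg1.
apply/permP=> p; apply: val_inj; rewrite val_wpermX perm1.
have : val p \in points by apply: valP.
case: (val p) => i v pL.
have tr j : j.+1 < size L -> traced (pc j) (pc j.+1) [:: 1] (fun k => k %| 7).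
  by move/joinable_L => /and4P[].
have nc : ~~ ((v \in core (pc i)) && ([:: 1] == commw)) by rewrite andbF.
have [j [_ /dvdnP[k ->] ej]] := tracedE tr pL nc.
by rewrite iterM; elim: k => // k IH; rewrite iterS IH.
Qed.

Lemma xpermK : involutive xperm.
Proof. by move=> p; rewrite !permE xfunK. Qed.

Lemma yperm3 : (yperm ^+ 3 = 1)%g.
Proof. by apply/permP=> p; rewrite permX perm1 /= !permE yfun3. Qed.

(** * The 17-cycle and generation of the alternating group *)

Local Notation H := (pc 0).
Hypothesis head_L : good_head H (pc 1).
Hypothesis core_L : forall i, 0 < i < size L -> core (pc i) = [::].
Hypothesis connected_L : forall i, 0 < i < size L -> connected_from (pc i) 0.

Local Notation S := (core H).

Let L0 : 0 < size L. Proof. by lia. Qed.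

Let size_core : size S = 17.
Proof. by case/and3P: head_L => _ /eqP. Qed.
Let uniq_core : uniq S.
Proof. by case/and4P: head_L. Qed.
Let core_points v : v \in S -> (0, v) \in points.
Proof.
case/and5P: head_L => _ _ _ _ /andP[/allP lt _] vS.
by rewrite mem_points L0 /= lt.
Qed.
Let core_run v : v \in S ->
  run L commw (0, v) = (0, nth 0 (seq.rot 1 S) (index v S)).
Proof.
case/and5P: head_L => _ _ _ _ /and3P[_ /eqP Er _] vS.
have := congr1 (fun s => nth None s (index v S)) Er.
rewrite !(nth_map 0) ?size_rot ?index_mem // nth_index //.
by case/(pair_runE (i := 0) (b := 0) erefl erefl isT) => _.
Qed.

Let inS j : nth 0 S (j %% 17) \in S.
Proof. by rewrite mem_nth // size_core ltn_mod. Qed.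

(** Indices are read modulo 17, so that w acts on the core as the successor, without a separate
    wrap-around case. *)
Definition core_pt j : T := SeqSub (core_points (inS j)).

Lemma core_ptS j : wperm commw (core_pt j) = core_pt j.+1.
Proof.
apply: val_inj; rewrite val_wperm [LHS](core_run (inS j)).
have k17 : j %% 17 < 17 by rewrite ltn_mod.
rewrite index_uniq ?size_core //= -[j.+1]addn1 -modnDml addn1.
move: k17; move: (j %% 17) => k k17; congr pair.
move: size_core uniq_core; case: S => // a s [ss] _; rewrite rot1_cons nth_rcons ss.
have [k16|] := ltnP k 16; first by rewrite modn_small.
by move=> k16; have -> : k = 16 by lia.
Qed.

Lemma core_ptX m j : ((wperm commw ^+ m)%g (core_pt j)) = core_pt (m + j).
Proof. by rewrite permX; elim: m => // m IH; rewrite iterS IH core_ptS. Qed.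

Lemma core_pt_mod i j : i = j %[mod 17] -> core_pt i = core_pt j.
Proof. by move=> e; apply: val_inj; rewrite /= e. Qed.

Lemma core_pt_neq j : core_pt j.+1 != core_pt j.
Proof.
apply/eqP=> /(congr1 val) /= [] /eqP.
rewrite nth_uniq ?size_core ?ltn_mod ?uniq_core // => /eqP; lia.
Qed.

Lemma core_pt_onto p : (val p).1 = 0 -> (val p).2 \in S -> exists j, p = core_pt j.
Proof.
move=> p0 pS; exists (index (val p).2 S); apply: val_inj => /=.
have := pS; rewrite -index_mem size_core => /modn_small->.
by rewrite nth_index //; case: p p0 {pS} => [[i v] ip] /= ->.
Qed.

(** This exponent is 1 modulo 17 and divisible by every length up to 61 that is prime to 17. The
    corresponding power of w agrees with w on the core and is trivial elsewhere. *)
Definition cyc_exp :=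
  chinese 17 (\prod_(1 <= k < fuel.+2 | ~~ (17 %| k)) k) 1 0.

Let g := (wperm commw ^+ cyc_exp)%g.

Let cop : coprime 17 (\prod_(1 <= k < fuel.+2 | ~~ (17 %| k)) k).
Proof.
rewrite coprime_sym; elim/big_ind: _ => [|a b|k ]; first exact: coprime1n.
  by rewrite coprimeMl => -> ->.
by rewrite coprime_sym prime_coprime.
Qed.

Lemma cyc_core j : g (core_pt j) = core_pt j.+1.
Proof.
rewrite /g core_ptX; apply: core_pt_mod.
by rewrite -modnDml (chinese_modl cop) modnDml.
Qed.

Lemma cyc_off p : (forall j, p != core_pt j) -> g p = p.
Proof.
move=> np; have : val p \in points by apply: valP.
case ep: (val p) => [i v] pL.
have tr j : j.+1 < size L -> traced (pc j) (pc j.+1) commw (fun k => ~~ (17 %| k)).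
  by move/joinable_L => /and4P[].
have iL : i < size L by move: pL; rewrite mem_points => /andP[].
have nc : ~~ ((v \in core (pc i)) && (commw == commw)).
  rewrite andbT; apply/negP=> vc; case: (posnP i) => [i0|i0].
    have [j pj] : exists j, p = core_pt j.
      by rewrite i0 in vc; apply: core_pt_onto; rewrite ep.
    by have := np j; rewrite pj eqxx.
  by move: vc; rewrite core_L ?i0.
have [j [j0 oj ej]] := tracedE tr pL nc.
have wj : (wperm commw ^+ j)%g p = p by apply: val_inj; rewrite val_wpermX ep.
have /dvdnP[k ek] : j %| cyc_exp.
  have : cyc_exp = 0 %[mod \prod_(1 <= k < fuel.+2 | ~~ (17 %| k)) k].
    exact: (chinese_modr cop).
  rewrite mod0n => /eqP; apply: dvdn_trans.
  rewrite (big_rem j) ?mem_index_iota //= oj; exact: dvdn_mulr.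
by rewrite /g ek mulnC expgM permX; elim: k {ek} => // k IH; rewrite iterS IH.
Qed.

Let XY := <<[set xperm; yperm]>>%G.

Let xXY : xperm \in XY. Proof. by rewrite mem_gen // !inE eqxx. Qed.
Let yXY : yperm \in XY. Proof. by rewrite mem_gen // !inE eqxx orbT. Qed.
Let wXY w : wperm w \in XY.
Proof. by elim: w => [|e w IH] /=; rewrite ?group1 // !groupM ?groupX. Qed.

Let gXY : g \in XY. Proof. exact/groupX/wXY. Qed.

(** The conjugate of [g] by the word [cword] has the image of the core as support. By the count in
    [good_head] this meets the core in a single point, so the commutator is a 3-cycle. *)
Lemma linked_core : exists i, linked XY (core_pt i) (core_pt i.+1).
Proof.
pose h := wperm (cword H).
have def p : (forall j, p != core_pt j) \/ exists j, p = core_pt j.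
  case: (boolP ((val p).1 == 0)) => [/eqP p0|p0]; last first.
    by left=> j; apply: contra p0 => /eqP->.
  case: (boolP ((val p).2 \in S)) => pS; first by right; apply: core_pt_onto.
  by left=> j; apply: contra pS => /eqP->; apply: inS.
have gmoved p : g p != p -> exists j, p = core_pt j.
  by case: (def p) => // np; rewrite (cyc_off np) eqxx.
case/and5P: head_L => _ _ _ _ /and5P[_ _ _ _ /andP[/allP hrun /eqP hcount]].
pose a v := if pair_run H (pc 1) (cword H) (0, v) is Some p
   then (p.1 == 0) && (p.2 \in S) else false.
have haP j : a (nth 0 S (j %% 17)) <-> exists i, h (core_pt j) = core_pt i.
  have := hrun _ (inS j); rewrite /a.
  case er: (pair_run _ _ _ _) => [[b v]|//] _.
  have [_ erun] := pair_runE (i := 0) (b := 0) erefl erefl isT er.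
  have vh : val (h (core_pt j)) = (b, v) by rewrite val_wperm [LHS]erun.
  split=> [/andP[/eqP /= b0 vS]|[i ei]]; first by apply: core_pt_onto; rewrite vh.
  by move: vh; rewrite ei => -[<- <-] /=; apply: inS.
have [v0 ev0] : exists v0, filter a S = [:: v0].
  by move: hcount; rewrite -size_filter; case: filter => [|v0 [|]] //; exists v0.
have /andP[av0 v0S] : (a v0) && (v0 \in S) by rewrite -mem_filter ev0 inE.
have nthv v : v \in S -> nth 0 S (index v S %% 17) = v.
  by move=> vS; rewrite modn_small ?nth_index // -size_core index_mem.
set j0 := index v0 S; have [i0 ei0] : exists i, h (core_pt j0) = core_pt i.
  by apply/haP; rewrite nthv.
have uniq_j j i : h (core_pt j) = core_pt i -> core_pt j = core_pt j0.
  move=> e; have : nth 0 S (j %% 17) \in filter a S.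
    by rewrite mem_filter inS andbT; apply/haP; exists i.
  by rewrite ev0 inE => /eqP ej; apply: val_inj; rewrite /= ej nthv.
exists i0; rewrite -cyc_core; apply: (@linked_commutator _ _ _ (g ^ h)%g).
- exact: gXY.
- exact: groupJ gXY (wXY _).
- by rewrite cyc_core core_pt_neq.
- by rewrite -ei0 permJ (inj_eq perm_inj) cyc_core core_pt_neq.
move=> p gp; have [i ei] := gmoved p gp; rewrite -(permKV h p) permJ.
rewrite (inj_eq perm_inj) => /gmoved[j ej].
have e : h (core_pt j) = core_pt i by rewrite -ej permKV.
by rewrite permKV ei -e (uniq_j _ _ e).
Qed.

Lemma linked_cores i j : linked XY (core_pt i) (core_pt j).
Proof.
have [k Lk] := linked_core.
have step m : linked XY (core_pt (m + k)) (core_pt (m + k).+1).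
  elim: m => [//|m IH]; by have := linkedJ gXY IH; rewrite !cyc_core.
have from m : linked XY (core_pt k) (core_pt (m + k)).
  elim: m => [|m IH]; first by left.
  exact: linked_trans IH (step m).
have reach m : linked XY (core_pt k) (core_pt m).
  (* Going forward $m+16k$ steps from index $k$ reaches $m+17k$, so points before $k$ are reached
     too. *)
  have -> : core_pt m = core_pt (m + 16 * k + k) by apply: core_pt_mod; lia.
  exact: from.
exact: linked_trans (linked_sym (reach i)) (reach j).
Qed.

Let K p := linked XY (core_pt 0) p.

(** [u] preserves the relation and sends one core point to another, all core points being in one
    class; hence it preserves that class. *)
Let K_closed (u : {perm T}) i j : u \in XY -> u (core_pt i) = core_pt j ->
  forall p, K p -> K (u p).
Proof.
move=> uXY e p Kp; have L1' := linkedJ uXY (linked_cores i 0).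
apply: linked_trans (linkedJ uXY Kp); rewrite e in L1'.
exact: linked_trans (linked_cores 0 j) L1'.
Qed.

Let Kx p : K p -> K (xperm p).
Proof.
case/and5P: head_L => _ _ _ _ /and4P[_ _ /hasP[v vS /andP[nr pS]] _].
have [i ei] := core_pt_onto (p := SeqSub (core_points vS)) erefl vS.
have [j ej] : exists j, xperm (core_pt i) = core_pt j.
  have e : val (xperm (core_pt i)) = (0, px H v).
    rewrite val_xperm -ei /=; apply: xstep_inner => //.
    by case/andP: head_L => nl _; rewrite /in_left (negPf nl).
  by apply: core_pt_onto; rewrite e.
exact: K_closed xXY ej p.
Qed.

Let Ky p : K p -> K (yperm p).
Proof.
case/and5P: head_L => _ _ _ _ /and5P[_ _ _ /hasP[v vS pS] _].
have [i ei] := core_pt_onto (p := SeqSub (core_points vS)) erefl vS.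
have [j ej] : exists j, yperm (core_pt i) = core_pt j.
  have e : val (yperm (core_pt i)) = (0, py H v) by rewrite val_yperm -ei.
  by apply: core_pt_onto; rewrite e.
exact: K_closed yXY ej p.
Qed.

Let K_piece i r k : i < size L -> swept_by (pc i) r k ->
  (exists2 p, K p & val p = (i, r)) -> forall p, (val p).1 = i -> K p.
Proof.
move=> iL /allP conn Kr.
suff swept m v : v \in iter m (sweep (pc i)) [:: r] -> exists2 p, K p & val p = (i, v).
  move=> p ep; have : val p \in points by apply: valP.
  rewrite mem_points ep => /andP[_ vP].
  have := conn (val p).2; rewrite mem_iota => /(_ vP)/swept[q Kq eq].
  by suff -> : p = q by []; apply: val_inj; rewrite eq -ep; case: (val p).
elim: m v => [|m IH] v; first by rewrite inE => /eqP->.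
rewrite iterS mem_undup !mem_cat => /or3P[/IH //|/mapP[u /IH[p Kp ep] ->]|/mapP[u /IH[p Kp ep] ->]].
  have pL : (i, u) \in points by rewrite -ep; apply: valP.
  have := val_xperm p; rewrite ep; case: (xstepP pL) => [iL' v34|j ij v01|_ _ _ _].
  (* At a handle point [px] stays in place, so the sweep adds nothing there; elsewhere it agrees
     with x. *)
  - move=> _; exists p => //; rewrite ep; congr pair.
    have [_ _ _ /(_ iL')[h3 h4 _]] := goodP iL.
    by have /orP[/eqP->|/eqP->] : (u == 3) || (u == 4) by lia.
  - move=> _; exists p => //; rewrite ep; congr pair.
    have i0 : 0 < i by rewrite ij.
    have [_ _ /(_ i0)[h0 h1 _] _] := goodP iL.
    by have /orP[/eqP->|/eqP->] : (u == 0) || (u == 1) by lia.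
  by move=> e; exists (xperm p) => //; apply: Kx.
by exists (yperm p); [apply: Ky|rewrite val_yperm ep].
Qed.

(** Induction along the chain: x sends point 3 of one diagram to point 0 of the next, which is then
    swept from there. *)
Lemma K_all p : K p.
Proof.
have : val p \in points by apply: valP.
rewrite mem_points => /andP[]; move ei: (val p).1 => i; elim: i p ei => [|i IH] p ep iL _.
  case/and5P: (head_L) => _ _ _ cn _; apply: (K_piece L0 cn _ ep).
  exists (core_pt 0); first by left.
  by rewrite /= nth0.
have iL' : i < size L by lia.
apply: (K_piece iL _ _ ep); first by apply: connected_L.
have [t3 pxP _ /(_ iL)[_ _ t1]] := goodP iL'.
have qL : (i, 3) \in points by rewrite mem_points /= iL'; lia.
exists (xperm (SeqSub qL)); last by rewrite val_xperm xstep_right.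
by apply/Kx/IH => //=; lia.
Qed.

Lemma Alt_chain : ('Alt_T \subset XY)%g.
Proof.
apply: Alt_sub_linked => [|p q]; last first.
  exact: linked_trans (linked_sym (K_all p)) (K_all q).
rewrite card_seq_sub ?uniq_points //; apply: (@leq_trans 17) => //.
rewrite -size_core -(size_map (pair 0)); apply: uniq_leq_size.
  by rewrite map_inj_uniq ?uniq_core // => u v [].
by move=> p /mapP[v vS ->]; apply: core_points.
Qed.

(** * Counting points and fixed points *)

Let count_points (a : pred (nat * nat)) (b : piece -> pred nat) :
  (forall i v, (i, v) \in points -> a (i, v) = b (pc i) v) ->
  #|[set p : T | a (val p)]| =
    sumn [seq count (b P) (iota 0 (psize P)) | P <- L].
Proof.
move=> ab.
have -> : #|[set p : T | a (val p)]| = count a points.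
  rewrite cardsE cardE size_filter /= -enumT -(count_map val).
  apply/seq.permP/uniq_perm; rewrite ?uniq_points ?(map_inj_uniq val_inj) ?enum_uniq //.
  move=> p; apply/mapP/idP=> [[q _ ->]|pL]; first exact: valP.
  by exists (SeqSub pL); rewrite ?mem_enum.
rewrite count_flatten -map_comp -[in RHS](mkseq_nth nopiece L) /mkseq -map_comp.
congr sumn; apply/eq_in_map => i; rewrite mem_iota add0n /= => iL.
rewrite count_map; apply: eq_in_count => v; rewrite mem_iota add0n /= => vP.
by apply: ab; rewrite mem_points /= iL.
Qed.

Lemma card_chain : #|{: T}| = sumn [seq psize P | P <- L].
Proof.
rewrite -cardsT; have -> : [set: T] = [set p : T | predT (val p)].
  by apply/setP=> p; rewrite !inE.
rewrite (@count_points predT (fun _ => predT)) //; congr sumn.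
by apply: eq_map => P; rewrite count_predT size_iota.
Qed.

Lemma nfix_xperm : nfix xperm = sumn [seq fixed_x P | P <- L].
Proof.
pose a p := xstep L p == p.
have -> : nfix xperm = #|[set p : T | a (val p)]|.
  by apply: eq_card => p; rewrite !inE -(inj_eq val_inj) val_xperm.
apply: (count_points (b := fun P v => [&& ~~ in_right P v, ~~ in_left P v & px P v == v])).
move=> i v pL; rewrite /a; case: (xstepP pL) => [_ _|j -> _|_ _ _ _] /=.
- by apply/eqP=> -[]; lia.
- by apply/eqP=> -[]; lia.
by rewrite xpair_eqE eqxx.
Qed.

Lemma nfix_yperm : nfix yperm = sumn [seq fixed_y P | P <- L].
Proof.
pose a p := ystep L p == p.
have -> : nfix yperm = #|[set p : T | a (val p)]|.
  by apply: eq_card => p; rewrite !inE -(inj_eq val_inj) val_yperm.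
apply: (count_points (b := fun P v => py P v == v)).
by move=> i v pL; rewrite /a xpair_eqE eqxx.
Qed.

Lemma nfix_xyperm : nfix (xperm * yperm)%g = sumn [seq fixed_xy P | P <- L].
Proof.
pose a p := ystep L (xstep L p) == p.
have -> : nfix (xperm * yperm)%g = #|[set p : T | a (val p)]|.
  by apply: eq_card => p; rewrite !inE permM -(inj_eq val_inj) val_yperm val_xperm.
apply: (count_points (b := fun P v => [&& ~~ in_right P v, ~~ in_left P v & py P (px P v) == v])).
move=> i v pL; rewrite /a; case: (xstepP pL) => [_ _|j -> _|_ _ _ _] /=.
- by apply/eqP=> -[]; lia.
- by apply/eqP=> -[]; lia.
by rewrite xpair_eqE eqxx.
Qed.

End Chain.

(** * The twelve diagrams *)

(* Found by a computer search among planar diagrams; a name ends with the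
   degree. *)
Definition head35 := Piece false true 11
  [:: 1; 10; 23; 22; 13; 18; 26; 33; 15; 6; 11; 14; 32; 19; 28; 24; 7] [:: 2;
     2; 1; 1; 2; 2; 1; 1; 2; 1; 2; 2; 1; 1; 2; 1]
  [:: 5; 6; 9; 3; 4; 0; 1; 11; 12; 2; 15; 7; 8; 18; 24; 10; 21; 27; 13; 19;
     29; 16; 26; 33; 14; 30; 22; 17; 32; 20; 25; 34; 28; 23; 31].

Definition head49 := Piece false true 16
  [:: 13; 48; 16; 25; 31; 41; 33; 27; 21; 19; 18; 26; 32; 38; 40; 28; 22] [::
     2; 1; 2; 1; 1; 2; 2; 1; 1; 2; 1; 1]
  [:: 5; 6; 9; 3; 4; 0; 1; 11; 12; 2; 15; 7; 8; 18; 24; 10; 21; 20; 13; 48;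
     17; 16; 26; 30; 14; 27; 22; 25; 32; 36; 23; 33; 28; 31; 39; 45; 29; 42;
     40; 34; 38; 41; 37; 43; 47; 35; 46; 44; 19].

Definition mid42 := Piece true true 14
  [::] [::]
  [:: 0; 1; 6; 3; 4; 38; 2; 9; 12; 7; 14; 15; 8; 18; 10; 11; 16; 24; 13; 21;
     27; 19; 26; 30; 17; 29; 22; 20; 33; 25; 23; 31; 39; 28; 36; 40; 34; 41;
     5; 32; 35; 37].

Definition mid56 := Piece true true 18
  [::] [::]
  [:: 0; 1; 6; 3; 4; 53; 2; 9; 12; 7; 14; 15; 8; 18; 10; 11; 21; 27; 13; 24;
     23; 16; 54; 20; 19; 29; 33; 17; 30; 25; 28; 35; 39; 26; 36; 31; 34; 42;
     48; 32; 45; 43; 37; 41; 55; 40; 51; 49; 38; 47; 52; 46; 50; 5; 22; 44].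

Definition mid72 := Piece true true 24
  [::] [::]
  [:: 0; 1; 6; 3; 4; 68; 2; 9; 12; 7; 14; 15; 8; 18; 10; 11; 21; 27; 13; 24;
     30; 16; 33; 26; 19; 29; 23; 17; 36; 25; 20; 39; 34; 22; 32; 42; 28; 38;
     37; 31; 44; 45; 35; 48; 40; 41; 51; 55; 43; 54; 57; 46; 60; 63; 49; 47;
     64; 50; 66; 61; 52; 59; 67; 53; 56; 69; 58; 62; 5; 65; 71; 70].

Definition cap7 := Piece true false 2
  [::] [::]
  [:: 0; 1; 3; 2; 4; 6; 5].

Definition cap15 := Piece true false 5
  [::] [::]
  [:: 0; 1; 3; 2; 6; 9; 4; 11; 12; 5; 10; 7; 8; 14; 13].

Definition cap22 := Piece true false 7
  [::] [::]
  [:: 0; 1; 3; 2; 6; 9; 4; 11; 12; 5; 15; 7; 8; 16; 21; 10; 13; 18; 17; 20;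
     19; 14].

Definition cap14 := Piece true false 4
  [::] [::]
  [:: 0; 1; 3; 2; 6; 9; 4; 11; 12; 5; 13; 7; 8; 10].

Definition cap21 := Piece true false 7
  [::] [::]
  [:: 0; 1; 3; 2; 6; 9; 4; 11; 12; 5; 15; 7; 8; 13; 18; 10; 16; 20; 14; 19;
     17].

Definition cap28 := Piece true false 9
  [::] [::]
  [:: 0; 1; 3; 2; 6; 9; 4; 11; 12; 5; 15; 7; 8; 13; 21; 10; 18; 24; 16; 23;
     20; 14; 26; 19; 17; 27; 22; 25].

Definition cap36 := Piece true false 12
  [::] [::]
  [:: 0; 1; 3; 2; 6; 9; 4; 11; 12; 5; 15; 7; 8; 18; 21; 10; 16; 23; 13; 24;
     27; 14; 25; 17; 19; 22; 30; 20; 31; 29; 26; 28; 33; 32; 35; 34].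

Definition heads := [:: head35; head49].
Definition mids := [:: mid42; mid56; mid72].
Definition caps := [:: cap7; cap15; cap22; cap14; cap21; cap28; cap36].

(** Conditions on [Q] alone are included, so that one path predicate supplies everything required of
    the diagrams after the head. *)
Definition linkable P Q :=
  [&& joinable P Q, good_piece Q, core Q == [::] & connected_from Q 0].

Lemma linkable_mids :
  all (fun P => all (linkable P) (mids ++ caps)) (heads ++ mids).
Proof. by vm_compute. Qed.

Lemma good_heads :
  all (fun P => good_piece P && all (good_head P) mids) heads.
Proof. by vm_compute. Qed.

Lemma caps_right : all (fun P => ~~ has_right P) caps.
Proof. by []. Qed.

(** * Chains given by numerical configurations *)

Record config := Config { hd : nat; cap : nat; n42 : nat; n56 : nat; n72 : nat }.

Definition middle c :=
  nseq (n42 c) mid42 ++ nseq (n56 c) mid56 ++ nseq (n72 c) mid72.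
Definition chain c :=
  nth nopiece heads (hd c) :: middle c ++ [:: nth nopiece caps (cap c)].
(** At least one middle diagram is required because [good_head] is verified only against a middle
    diagram as successor. *)
Definition proper c := [&& hd c < 2, cap c < 7 & 0 < n42 c + n56 c + n72 c].

Lemma path_nseq_cat (T : Type) (r : rel T) a P n s :
  r a P -> r P P -> path r a s -> path r P s -> path r a (nseq n P ++ s).
Proof. by elim: n a => //= n IH a aP PP ras rPs; rewrite aP; apply: IH. Qed.

Lemma path_chain c : proper c ->
  path linkable (nth nopiece heads (hd c))
    (middle c ++ [:: nth nopiece caps (cap c)]).
Proof.
case/and3P=> h2 e7 _; set h := nth _ _ _; set e := nth _ _ _.
have ok P k : P = h \/ P = mid42 \/ P = mid56 \/ P = mid72 -> k < 10 ->
    linkable P (nth nopiece (mids ++ caps) k).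
  move=> Pin k10; suff /(all_nthP nopiece)/(_ k k10) : all (linkable P) (mids ++ caps) by [].
  have A := all_nthP nopiece linkable_mids.
  case: Pin => [->|[->|[->|->]]]; [|exact: (A 2)|exact: (A 3)|exact: (A 4)].
  have := A (hd c); rewrite nth_cat h2 => -> //.
  exact: leq_trans h2 _.
have okc P : P = h \/ P = mid42 \/ P = mid56 \/ P = mid72 -> linkable P e.
  move=> Pin; have k10 : 3 + cap c < 10 by lia.
  by have := ok P (3 + cap c) Pin k10; rewrite (nth_cat _ mids) ltnNge leq_addr addKn.
rewrite /middle -!catA.
have k0 P : P = h \/ P = mid42 \/ P = mid56 \/ P = mid72 -> linkable P mid42.
  by move=> Pin; apply: (ok P 0).
have k1 P : P = h \/ P = mid42 \/ P = mid56 \/ P = mid72 -> linkable P mid56.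
  by move=> Pin; apply: (ok P 1).
have k2 P : P = h \/ P = mid42 \/ P = mid56 \/ P = mid72 -> linkable P mid72.
  by move=> Pin; apply: (ok P 2).
have c3 P : P = h \/ P = mid42 \/ P = mid56 \/ P = mid72 -> path linkable P [:: e].
  by move=> Pin; rewrite /= okc.
have c2 P : P = h \/ P = mid42 \/ P = mid56 \/ P = mid72 ->
    path linkable P (nseq (n72 c) mid72 ++ [:: e]).
  by move=> Pin; apply: path_nseq_cat; [exact: k2|apply: k2; tauto|exact: c3|apply: c3; tauto].
have c1 P : P = h \/ P = mid42 \/ P = mid56 \/ P = mid72 ->
    path linkable P (nseq (n56 c) mid56 ++ nseq (n72 c) mid72 ++ [:: e]).
  by move=> Pin; apply: path_nseq_cat; [exact: k1|apply: k1; tauto|exact: c2|apply: c2; tauto].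
by apply: path_nseq_cat; [apply: k0; tauto|apply: k0; tauto|apply: c1; tauto|apply: c1; tauto].
Qed.

Definition total (f : piece -> nat) c :=
  f (nth nopiece heads (hd c)) + n42 c * f mid42 + n56 c * f mid56 +
  n72 c * f mid72 + f (nth nopiece caps (cap c)).

Lemma total_chain f c : sumn [seq f P | P <- chain c] = total f c.
Proof.
rewrite /chain /middle /total /= !map_cat !sumn_cat !map_nseq !sumn_nseq /= addn0.
by rewrite !addnA !(mulnC (f _)).
Qed.

Lemma triple_of_config c (n := total psize c) : proper c ->
  8 %| n - total fixed_x c -> total fixed_x c < n -> total fixed_y c < n ->
  total fixed_xy c < n ->
  exists (T : finType) (x y : {perm T}), [/\ #|T| = n, triple_in_Alt x y,
    nfix x = total fixed_x c, nfix y = total fixed_y c &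
    nfix (x * y)%g = total fixed_xy c].
Proof.
move=> pr n8 fx fy fxy; set L := chain c; have /and3P[h2 e7 m0] := pr.
have p_L := path_chain pr.
have sz : size L = (n42 c + n56 c + n72 c).+2.
  by rewrite /L /chain /middle /= !size_cat !size_nseq /=; lia.
have lk i : i.+1 < size L -> linkable (nth nopiece L i) (nth nopiece L i.+1).
  by move=> iL; have /(pathP nopiece)/(_ i iL) := p_L.
have /andP[gh gm] := all_nthP nopiece good_heads (hd c) h2.
have good_L : all good_piece L.
  apply/(all_nthP nopiece) => -[|i] iL; first exact: gh.
  by have /and4P[] := lk i iL.
have last_L : nth nopiece L (size L).-1 = nth nopiece caps (cap c).
  by rewrite nth_last /L /chain /= last_cat.
have head_L : good_head (nth nopiece L 0) (nth nopiece L 1).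
  have : exists2 k, k < 3 & nth nopiece L 1 = nth nopiece mids k.
    rewrite /L /chain /middle /=; move: m0.
    case: (n42 c) => [|?]; last by exists 0.
    case: (n56 c) => [|?]; last by exists 1.
    by case: (n72 c) => [|?] //; exists 2.
  by case=> k k3 ->; apply: (all_nthP nopiece gm).
have left_L i : i < size L -> has_left (nth nopiece L i) = (0 < i).
  case: i => [|i] iL; first by case/andP: head_L => /negPf.
  by have /and4P[/and4P[]] := lk i iL.
have right_L i : i < size L -> has_right (nth nopiece L i) = (i.+1 < size L).
  move=> iL; have [iL'|] := ltnP i.+1 (size L); first by have /and4P[/and4P[]] := lk i iL'.
  move=> Li; have -> : i = (size L).-1 by lia.
  rewrite last_L; apply: negPf.
  exact: (all_nthP nopiece caps_right (cap c) e7).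
have L1 : 1 < size L by rewrite sz.
have join_L i : i.+1 < size L -> joinable (nth nopiece L i) (nth nopiece L i.+1).
  by move/lk => /and4P[].
have core_L i : 0 < i < size L -> core (nth nopiece L i) = [::].
  by case: i => // i /= /lk /and4P[_ _ /eqP].
have conn_L i : 0 < i < size L -> connected_from (nth nopiece L i) 0.
  by case: i => // i /= /lk /and4P[].
pose x := xperm good_L left_L right_L; pose y := yperm good_L left_L right_L.
have cardT : #|{: seq_sub (points L)}| = n by rewrite card_chain total_chain.
have nx : nfix x = total fixed_x c by rewrite -(total_chain fixed_x); exact: nfix_xperm.
have ny : nfix y = total fixed_y c by rewrite -(total_chain fixed_y); exact: nfix_yperm.
have nxy : nfix (x * y)%g = total fixed_xy c by rewrite -(total_chain fixed_xy); exact: nfix_xyperm.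
have nfix1 : nfix (1 : {perm seq_sub (points L)})%g = n.
  by rewrite -cardT -cardsT; apply: eq_card => p; rewrite !inE perm1 eqxx.
exists (seq_sub (points L)), x, y; split=> //; split.
- by split; [exact: xpermK|exact: yperm3|exact: xyperm7].
- split; [move: fx|move: fy|move: fxy]; rewrite -?nx -?ny -?nxy; apply: contraTneq => ->;
  by rewrite nfix1 ltnn.
- exact: Alt_chain.
suff -> : #|moved x| = n - total fixed_x c by [].
have e1 : #|[pred p | x p == p]| = nfix x by rewrite /nfix cardsE.
have e2 : #|moved x| = #|[predC [pred p | x p == p]]|.
  by apply: eq_card => p; rewrite !inE.
by rewrite e2 -nx -e1 -cardT -(cardC [pred p | x p == p]) addKn.
Qed.

(** The number of copies of [mid42] is determined by the other data. Rounding and truncated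
    subtraction are harmless, since candidates of the wrong degree are filtered out. *)
Definition configs n :=
  [seq c <- [seq Config p.1 p.2
                   ((n - total psize (Config p.1 p.2 0 q.1 q.2)) %/ 42) q.1 q.2
             | p <- [seq (h, e) | h <- iota 0 2, e <- iota 0 7],
               q <- [seq (j, k) | j <- iota 0 12, k <- iota 0 10]]
  | total psize c == n].

Definition admissible n c :=
  [&& total psize c == n, proper c, 8 %| n - total fixed_x c,
      total fixed_x c < n & (total fixed_y c < n) && (total fixed_xy c < n)].
Definition separated c d :=
  [&& total fixed_x c != total fixed_x d, total fixed_y c != total fixed_y d
    & total fixed_xy c != total fixed_xy d].
Definition solvable_degree n :=
  let s := [seq c <- configs n | admissible n c] in
  has (fun c => has (separated c) s) s.

(** Since $42=3\cdot 14$, three consecutive degrees in each class modulo 14 represent all classes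
    modulo 42 above it. *)
Lemma solvable_bases :
  all (fun r => (hurwitz_bound r == r %[mod 14]) &&
    all (fun t => solvable_degree (hurwitz_bound r + 112 + 14 * t)) (iota 0 3))
  (iota 0 14).
Proof. by vm_compute. Qed.

Definition extend q c :=
  Config (hd c) (cap c) (n42 c + q) (n56 c) (n72 c).

Lemma total_extend f q c : total f (extend q c) = total f c + q * f mid42.
Proof. by rewrite /total /=; lia. Qed.

(** Each further [mid42] adds 42 points, of which x moves $40=8\cdot 5$, so the lifting condition
    persists. *)
Lemma admissible_extend q n c :
  admissible n c -> admissible (n + 42 * q) (extend q c).
Proof.
have [ex ey exy] : [/\ fixed_x mid42 = 2, fixed_y mid42 = 0 & fixed_xy mid42 = 0].
  by split; vm_compute.
rewrite /admissible !total_extend ex ey exy.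
case/and5P=> /eqP sz /and3P[h2 e7 m0] /dvdnP[k ek] fx /andP[fy fxy].
apply/and5P; split; [by rewrite sz mulnC| | |lia|by apply/andP; split; lia].
  by rewrite /proper /= h2 e7 /=; lia.
by apply/dvdnP; exists (k + 5 * q); lia.
Qed.

Lemma separated_extend q c d :
  separated c d -> separated (extend q c) (extend q d).
Proof. by rewrite /separated !total_extend !eqn_add2r. Qed.

Lemma beauville_of_degree n q (gT : finGroupType) (G : {group gT}) :
  solvable_degree n -> is_double_cover_Alt (n + 42 * q) G ->
  doubly_hurwitz_beauville G.
Proof.
move=> sol [iota [Zi oi di isoG]].
have [c [d [Ac Ad scd]]] : exists c d,
    [/\ admissible n c, admissible n d & separated c d].
  pose c0 := Config 0 0 0 0 0; move: sol; rewrite /solvable_degree.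
  set s := [seq c <- _ | _]; have As := all_nthP c0 (filter_all (admissible n) (configs n)).
  case/(has_nthP c0)=> i iS /(has_nthP c0)[j jS sep].
  by exists (nth c0 s i), (nth c0 s j); split=> //; apply: As.
have triple e : admissible n e -> exists x y : {perm 'I_(n + 42 * q)},
    [/\ triple_in_Alt x y,
      nfix x = total fixed_x (extend q e), nfix y = total fixed_y (extend q e) &
      nfix (x * y)%g = total fixed_xy (extend q e)].
  move/(admissible_extend q)=> /and5P[/eqP sz pr n8 fx /andP[fy fxy]].
  have [||||T [x [y [cT t <- <- <-]]]] := triple_of_config pr; rewrite ?sz //.
  by apply: (transport_triple _ t); rewrite cT sz card_ord.
have [x1 [y1 [t1 fx1 fy1 fxy1]]] := triple c Ac.
have [x2 [y2 [t2 fx2 fy2 fxy2]]] := triple d Ad.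
have sep := separated_extend q scd; have [f [kf imf]] := cover_morphism Zi isoG.
apply: (beauville_of_triples Zi oi di kf imf t1 t2).
by rewrite fx1 fx2 fy1 fy2 fxy1 fxy2; case/and3P: sep.
Qed.

Theorem corollary1p2 :
  (forall r n : nat,
     r < 14 -> n = r %[mod 14] -> hurwitz_bound r + 112 <= n ->
     forall (gT : finGroupType) (G : {group gT}),
       is_double_cover_Alt n G -> doubly_hurwitz_beauville G)
  /\
  (forall n : nat, 701 <= n ->
     forall (gT : finGroupType) (G : {group gT}),
       is_double_cover_Alt n G -> doubly_hurwitz_beauville G).
Proof.
have main r n : r < 14 -> n = r %[mod 14] -> hurwitz_bound r + 112 <= n ->
    forall (gT : finGroupType) (G : {group gT}),
    is_double_cover_Alt n G -> doubly_hurwitz_beauville G.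
  move=> r14 nr nN gT G; have r_in : r \in iota 0 14 by rewrite mem_iota.
  have /andP[/eqP Nr /allP sol] := allP solvable_bases r r_in.
  move: (hurwitz_bound r) nN Nr sol => N nN Nr sol.
  pose t := (n - (N + 112)) %/ 14.
  (* The remainder of [t] modulo 3 selects a verified degree, and the quotient is the number of
     added copies of [mid42]. *)
  have -> : n = N + 112 + 14 * (t %% 3) + 42 * (t %/ 3) by rewrite /t; lia.
  by apply/beauville_of_degree/sol; rewrite mem_iota ltn_mod.
split=> // n n701; have r14 : n %% 14 < 14 by rewrite ltn_mod.
apply: (main (n %% 14) n r14); first by rewrite modn_mod.
(* The largest of the fourteen bounds is $589+112=701$. *)
apply: leq_trans n701.
by move: (n %% 14) r14; do 14?case=> //.
Qed.
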